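(* If $F$ is a 4-regular graph, then the number $c(F)$ of connected components of $F$ together with the parametrized Tutte polynomial of the transition matroid $M_{\tau}(F)$ (with suitably chosen weight functions) determine the Martin polynomial of $F$ and the directed Martin polynomials of all balanced orientations of $F$.
   Context: For a matroid $M$ on $S$ with rank function $r$ and weights $\alpha,\beta:S\to R$ ($R$ a commutative ring), the parametrized Tutte polynomial is $\sum_{A\subseteq S}\prod_{a\in A}\alpha(a)\prod_{s\in S-A}\beta(s)(x-1)^{r(S)-r(A)}(y-1)^{|A|-r(A)}$. Graphs may have loops and multiple edges; each edge consists of two half-edges, each incident on one vertex; a 4-regular graph has four half-edges at each vertex. A transition at $v$ is a partition of the four half-edges at $v$ into two pairs; $\mathfrak{T}(F)$ is the set of transitions. A circuit is a closed walk using pairwise distinct half-edges (up to cyclic permutation and reversal); a circuit partition $P$ partitions $E(F)$ into circuits, and determines one transition at each vertex (the pairing of half-edges by its passages through $v$); $|P|$ is its number of circuits. An Euler system is a circuit partition with exactly one circuit per connected component. For an Euler system $C$: vertices $v\neq w$ are interlaced if they occur as $v\dots w\dots v\dots w$ on a circuit of $C$, $\mathcal{A}$ is the $GF(2)$ adjacency matrix of the interlacement graph on $V(F)$; $\phi_C(v)$ is the transition of $C$ at $v$, $\chi_C(v)$ the other transition pairing entering with leaving half-edges under an orientation of the circuit, $\psi_C(v)$ the third. $M_{\tau}(F)$ is the binary matroid on $\mathfrak{T}(F)$ represented by $(I\mid\mathcal{A}\mid I+\mathcal{A})$, the columns for $v$ indexed by $\phi_C(v),\chi_C(v),\psi_C(v)$;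 it is independent of $C$. The Martin polynomial (Las Vergnas's form) is $m(F;\zeta)=\sum_P(\zeta-1)^{|P|-1}$ over all circuit partitions $P$ of $F$. A balanced orientation of $F$ directs each edge so that each vertex has two incoming and two outgoing half-edges; a transition is consistent with it if each of its pairs contains one incoming and one outgoing half-edge, and the directed Martin polynomial is $\sum_P(\zeta-1)^{|P|-1}$ over circuit partitions $P$ all of whose transitions are consistent with the orientation. *)

(* Defs.v *)
(* Mathematical Components *)
From HB Require Import structures.
From mathcomp Require Import all_boot all_order all_algebra.

Set Implicit Arguments.
Unset Strict Implicit.
Unset Printing Implicit Defensive.

Import GRing.Theory.

(** * Matroids and the parametrized Tutte polynomial *)

Record matroid (S : finType) := Matroid {
  mrank :> {set S} -> nat;
  mrank_card : forall A : {set S}, mrank A <= #|A|;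
  mrank_mono : forall A B : {set S}, A \subset B -> mrank A <= mrank B;
  mrank_submod : forall A B : {set S},
    mrank (A :|: B) + mrank (A :&: B) <= mrank A + mrank B }.

Section ColumnMatroid.

(* A matrix with m rows whose columns are indexed by the finite type S. *)
Variables (K : fieldType) (S : finType) (m : nat) (N : S -> 'cV[K]_m).

Definition column_submatrix (A : {set S}) : 'M[K]_(m, #|A|) :=
  (\matrix_(i, j) N (enum_val j) i 0)%R.

Definition column_rank (A : {set S}) : nat := \rank (column_submatrix A).

Definition column_span (A : {set S}) : 'M[K]_m :=
  (\sum_(s in A) <<(N s)^T%R>>)%MS.

Lemma column_rankE (A : {set S}) : column_rank A = \rank (column_span A).
Proof.
rewrite /column_rank -mxrank_tr; apply: eqmx_rank; apply/andP; split.
  apply/row_subP=> j.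
  have -> : (row j (column_submatrix A)^T = (N (enum_val j))^T)%R.
    by apply/rowP=> i; rewrite !mxE.
  by apply: (sumsmx_sup (enum_val j)); rewrite ?enum_valP // genmxE.
apply/sumsmx_subP=> s sA; rewrite genmxE.
have -> : ((N s)^T = row (enum_rank_in sA s) (column_submatrix A)^T)%R.
  by apply/rowP=> i; rewrite !mxE enum_rankK_in.
exact: row_sub.
Qed.

Lemma column_rank_card A : column_rank A <= #|A|.
Proof. exact: rank_leq_col. Qed.

Lemma column_rank_mono (A B : {set S}) :
  A \subset B -> column_rank A <= column_rank B.
Proof.
move=> /subsetP sAB; rewrite !column_rankE; apply/mxrankS/sumsmx_subP=> s sA.
exact: (sumsmx_sup s (sAB s sA)).
Qed.

Lemma column_rank_submod (A B : {set S}) :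
  column_rank (A :|: B) + column_rank (A :&: B)
     <= column_rank A + column_rank B.
Proof.
rewrite !column_rankE -(mxrank_sum_cap (column_span A) _).
apply: leq_add; apply: mxrankS.
  apply/sumsmx_subP=> s; rewrite inE => /orP[] h.
    exact/(submx_trans _ (addsmxSl _ _))/(sumsmx_sup s).
  exact/(submx_trans _ (addsmxSr _ _))/(sumsmx_sup s).
by rewrite sub_capmx; apply/andP; split; apply/sumsmx_subP=> s;
  rewrite inE => /andP[h1 h2]; apply: (sumsmx_sup s).
Qed.

Definition column_matroid : matroid S :=
  Matroid column_rank_card column_rank_mono column_rank_submod.

End ColumnMatroid.

(* An element of R[x][y]: x is ['X%:P] and y is ['X]. *)
Definition parametrized_tutte (R : comNzRingType) (S : finType)
    (M : matroid S) (alpha beta : S -> R) : {poly {poly R}} :=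
  (\sum_(A : {set S})
      ((\prod_(a in A) alpha a * \prod_(s in ~: A) beta s)%:P)%:P
      * ('X%:P - 1) ^+ (M [set: S] - M A)
      * ('X - 1) ^+ (#|A| - M A))%R.

(** * Graphs given by half-edges *)

(* The edges are the pairs {h, mate h}; loops and parallel edges are allowed,
   edges without a vertex are not. *)
Record graph := Graph {
  vertex : finType;
  halfedge : finType;
  inc : halfedge -> vertex;
  mate : halfedge -> halfedge;
  mateK : involutive mate;
  mate_neq : forall h, mate h != h }.

Section FourRegular.

Variable F : graph.
Implicit Types (v w : vertex F) (h : halfedge F).

Definition star v : {set halfedge F} := [set h | inc h == v].

Definition four_regular : Prop := forall v, #|star v| = 4.

Definition adjacent : rel (vertex F) :=
  fun v w => [exists h, (inc h == v) && (inc (mate h) == w)].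

Definition ncomponents : nat := n_comp adjacent (vertex F).

Definition is_transition_at v (t : {set {set halfedge F}}) : bool :=
  partition t (star v) && [forall p in t, #|p| == 2].

Definition transition : Type :=
  {vt : vertex F * {set {set halfedge F}} | is_transition_at vt.1 vt.2}.

Definition tvertex (t : transition) : vertex F := (val t).1.
Definition tpairs (t : transition) : {set {set halfedge F}} := (val t).2.

(* A closed walk h_1, mate h_1, h_2, mate h_2, ..., h_k, mate h_k (k > 0) is
   recorded by the half-edges h_1, ..., h_k through which it leaves its
   successive vertices. *)
Definition closed_trail (s : seq (halfedge F)) : bool :=
  [&& s != [::], cycle (fun g h => inc (mate g) == inc h) s
    & uniq (s ++ map (@mate F) s)].

Definition same_circuit (s t : seq (halfedge F)) : bool :=
  [exists k : 'I_(size s).+1,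
     (t == rot k s) || (t == rot k (rev (map (@mate F) s)))].

(* The length bound only makes the type finite: a closed trail has no repeated
   half-edge, hence satisfies it. *)
Definition walk : Type := {bseq #|halfedge F| of halfedge F}.

(* A circuit is an equivalence class of closed trails, so its elements are its
   parametrizations, with all base points and in both directions. *)
Definition is_circuit (c : {set walk}) : bool :=
  [exists s : walk, closed_trail s && (c == [set t : walk | same_circuit s t])].

(* The edge of h is on c; either direction of c may be used, so h may be taken
   to be traversed from h to mate h. *)
Definition on_circuit h (c : {set walk}) : bool :=
  [exists s in c, h \in val s].

Definition circuit_partition (P : {set {set walk}}) : bool :=
  [forall c in P, is_circuit c]
  && [forall h, #|[set c in P | on_circuit h c]| == 1].

(* The pairs of half-edges {entering, leaving} of the passages of P through v. *)
Definition passages (P : {set {set walk}}) v : {set {set halfedge F}} :=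
  [set p | [exists c in P, [exists s in c, [exists h,
     [&& h \in val s, inc (mate h) == v
       & p == [set mate h; next (val s) h]]]]]].

Definition meets_component v (c : {set walk}) : bool :=
  [exists h, on_circuit h c && connect adjacent v (inc h)].

Definition euler_system (C : {set {set walk}}) : bool :=
  circuit_partition C
  && [forall v, #|[set c in C | meets_component v c]| == 1].

(** * The transition matroid *)

Definition interlaced (C : {set {set walk}}) v w : bool :=
  (v != w) &&
  [exists c in C, [exists s in c,
     subseq [:: v; w; v; w] (map (@inc F) (val s))]].

Definition interlace_matrix (C : {set {set walk}}) : 'M['F_2]_#|vertex F| :=
  (\matrix_(i, j) (interlaced C (enum_val i) (enum_val j))%:R)%R.

Definition is_phi (C : {set {set walk}}) (t : transition) : bool :=
  tpairs t == passages C (tvertex t).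

(* The parametrization s of c is an orientation of c: its leaving half-edges
   are the elements of s and its entering ones are their mates. *)
Definition is_chi (C : {set {set walk}}) (t : transition) : bool :=
  ~~ is_phi C t &&
  [exists c in C, [exists s in c, [forall p in tpairs t, [exists g, [exists h,
     [&& g \in val s, h \in val s & p == [set mate g; h]]]]]]].

Definition transition_column (C : {set {set walk}}) (t : transition) :
    'cV['F_2]_#|vertex F| :=
  col (enum_rank (tvertex t))
    (if is_phi C t then 1%:M%R
     else if is_chi C t then interlace_matrix C
     else (1%:M + interlace_matrix C)%R).

Definition transition_matroid (C : {set {set walk}}) : matroid transition :=
  column_matroid (transition_column C).

(** * Martin polynomials *)

(* |P| = 0 only happens for the graph with no vertex; then (zeta - 1)^(-1) is
   replaced by 1. *)
Definition martin : {poly int} :=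
  (\sum_(P : {set {set walk}} | circuit_partition P)
      ('X - 1) ^+ (#|P| - 1))%R.

(* An orientation is given by the set D of the outgoing half-edges: the edge
   {h, mate h} with h in D is directed from inc h to inc (mate h). *)
Definition balanced_orientation (D : {set halfedge F}) : bool :=
  [forall h, (mate h \in D) == (h \notin D)]
  && [forall v, (#|star v :&: D| == 2) && (#|star v :\: D| == 2)].

Definition consistent (D : {set halfedge F}) (t : {set {set halfedge F}}) :
    bool :=
  [forall p in t, (#|p :&: D| == 1) && (#|p :\: D| == 1)].

Definition directed_martin (D : {set halfedge F}) : {poly int} :=
  (\sum_(P : {set {set walk}} |
           circuit_partition P && [forall v, consistent D (passages P v)])
      ('X - 1) ^+ (#|P| - 1))%R.

End FourRegular.

(* Main.v *)
(* For transition systems the circuit-nullity formula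
     |P| - c(F) = |B| - r(B),   B the set of transitions of P,
   holds in the transition matroid, so the Martin polynomials are sums of
   (zeta - 1)^(|B| - r(B) + c(F) - 1) over transversals B, which have one
   transition per vertex.

   The formula is proved by counting the GF(2)-valued functions f on edges that
   are constant on the circuits of P; there are 2^|P| of them.  Along the Euler
   system C such an f jumps at each of the two passages through v by the same
   amount y(v), and y determines f up to a function constant on the components
   of F.  If h and k are the half-edges leaving v on C, summing the jumps from h
   to k gives f(h) + f(k) = y(v) + sum of y(w) over w interlaced with v, because
   a non-interlaced w is met an even number of times in between.  Hence
   compatibility with P at v is the linear condition y(v) = 0, (Ay)(v) = 0 or
   y(v) + (Ay)(v) = 0 as P follows phi, chi or psi, and the solutions y
   correspond to the kernel of the columns B, so 2^|P| = 2^(|B| - r(B)) 2^c(F).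

   The weights are s^(4^i) for a chosen and t^(4^i) for an omitted transition at
   the i-th vertex.  With three transitions at each vertex, the base 4 digits of
   the exponents show that the monomials s^j t^(2j) come exactly from the
   transversals; inconsistent transitions get the weight 0 when chosen. *)
Require Import Defs.
From HB Require Import structures.
From mathcomp Require Import all_boot all_order all_algebra.
From mathcomp Require Import mxabelem zify.

Set Implicit Arguments.
Unset Strict Implicit.
Unset Printing Implicit Defensive.

Import GRing.Theory.

(** * Closed trails and circuit partitions *)

Section Trails.

Variable F : graph.
Implicit Types (g h : halfedge F) (s t u : seq (halfedge F)) (c : {set walk F}).

Let mateK := @mateK F.
Let mate_inj : injective (@mate F) := inv_inj mateK.

Definition reverse s := rev (map (@mate F) s).

Lemma mem_reverse s h : (h \in reverse s) = (mate h \in s).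
Proof. by rewrite mem_rev -{1}(mateK h) mem_map. Qed.

Lemma reverseK : involutive reverse.
Proof. by move=> s; rewrite /reverse map_rev revK -map_comp map_id_in // => h _ /=. Qed.

Lemma size_reverse s : size (reverse s) = size s.
Proof. by rewrite size_rev size_map. Qed.

Lemma reverse_rot n s : exists m, reverse (rot n s) = rot m (reverse s).
Proof. by rewrite /reverse map_rot rev_rot; eexists. Qed.

Lemma same_circuitP s t :
  reflect (exists k, t = rot k s \/ t = rot k (reverse s)) (same_circuit s t).
Proof.
apply: (iffP existsP) => [[k /orP[/eqP->|/eqP->]]|[k E]].
- by exists k; left.
- by exists k; right.
have kP : minn k (size s) < (size s).+1 by rewrite ltnS geq_minr.
exists (Ordinal kP); case: E => ->; apply/orP; [left|right]; apply/eqP => /=.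
  by rewrite -rot_minn.
by rewrite [LHS]rot_minn size_reverse.
Qed.

Lemma same_circuit_refl s : same_circuit s s.
Proof. by apply/same_circuitP; exists 0; left; rewrite rot0. Qed.

Lemma same_circuit_rot n s : same_circuit s (rot n s).
Proof. by apply/same_circuitP; exists n; left. Qed.

Lemma same_circuit_reverse s : same_circuit s (reverse s).
Proof. by apply/same_circuitP; exists 0; right; rewrite rot0. Qed.

Lemma same_circuit_trans s t u :
  same_circuit s t -> same_circuit t u -> same_circuit s u.
Proof.
move=> /same_circuitP[k Ek] /same_circuitP[m Em]; apply/same_circuitP.
case: Ek Em => -> [->|->].
- by rewrite rot_rot_add; eexists; left.
- have [j ->] := reverse_rot k s.
  by rewrite rot_rot_add; eexists; right.
- by rewrite rot_rot_add; eexists; right.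
- have [j ->] := reverse_rot k (reverse s).
  by rewrite reverseK rot_rot_add; eexists; left.
Qed.

Lemma same_circuit_sym s t : same_circuit s t -> same_circuit t s.
Proof.
move=> /same_circuitP[k [->|->]].
  by rewrite -{2}(rotK k s); exact: same_circuit_rot.
apply: (@same_circuit_trans _ (reverse s)).
  by rewrite -{2}(rotK k (reverse s)); exact: same_circuit_rot.
by rewrite -{2}(reverseK s); exact: same_circuit_reverse.
Qed.

Lemma closed_trail_rot n s : closed_trail (rot n s) = closed_trail s.
Proof.
rewrite /closed_trail rot_cycle -!size_eq0 size_rot map_rot; congr [&& _, _ & _].
by apply: perm_uniq; apply: perm_cat; rewrite perm_rot.
Qed.

Lemma closed_trail_reverse s : closed_trail s -> closed_trail (reverse s).
Proof.
move=> /and3P[s0 cs us]; apply/and3P; split.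
- by rewrite -size_eq0 size_reverse size_eq0.
- rewrite /reverse rev_cycle cycle_map; apply: sub_cycle cs => g h /=.
  by rewrite mateK eq_sym.
- rewrite -(perm_uniq (_ : perm_eq (s ++ map (@mate F) s) _)) //.
  rewrite perm_catC; apply: perm_cat; first by rewrite perm_sym perm_rev.
  by rewrite map_rev -map_comp map_id_in 1?perm_sym ?perm_rev // => h _ /=.
Qed.

Lemma closed_trail_uniq s : closed_trail s -> uniq s.
Proof. by case/and3P=> _ _; rewrite cat_uniq => /andP[]. Qed.

Lemma closed_trail_mate s h : closed_trail s -> h \in s -> mate h \notin s.
Proof.
case/and3P=> _ _; rewrite cat_uniq => /and3P[_ /hasPn D _] hs.
by apply: D; rewrite mem_map.
Qed.

Lemma closed_trail_size s : closed_trail s -> size s <= #|halfedge F|.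
Proof. by move=> /closed_trail_uniq/card_uniqP <-; apply: max_card. Qed.

Lemma closed_trail_next s h :
  closed_trail s -> h \in s -> inc (next s h) = inc (mate h).
Proof.
by case/and3P=> _ cs _ hs; have /eqP := next_cycle cs hs.
Qed.

Lemma same_closed_trail s t : same_circuit s t -> closed_trail s -> closed_trail t.
Proof.
move=> /same_circuitP[k [->|->]] cs; rewrite closed_trail_rot //.
exact: closed_trail_reverse.
Qed.

(** The passage of [s] after [h] pairs [mate h] with [next s h]; the reversal runs through it
    backwards, arriving by [next s h] and leaving by [mate h]. *)
Lemma next_reverse s h :
  uniq s -> h \in s -> next (reverse s) (mate (next s h)) = mate h.
Proof.
move=> us hs; rewrite /reverse next_rev ?map_inj_uniq //.
rewrite -[LHS]/(prev _ _) -(next_map mate_inj us).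
by rewrite prev_next // map_inj_uniq.
Qed.

Definition circuit_of s : {set walk F} := [set t : walk F | same_circuit s t].

Lemma circuit_of_same s t : same_circuit s t -> circuit_of s = circuit_of t.
Proof.
move=> st; apply/setP=> u; rewrite !inE.
by apply/idP/idP; apply: same_circuit_trans => //; apply: same_circuit_sym.
Qed.

Lemma is_circuitP c :
  reflect (exists2 s, closed_trail s & c = circuit_of s) (is_circuit c).
Proof.
apply: (iffP existsP) => [[s /andP[cs /eqP->]]|[s cs ->]]; first by exists (val s).
by exists (Bseq (closed_trail_size cs)); rewrite /= cs eqxx.
Qed.

Lemma circuit_of_mem c (s : walk F) :
  is_circuit c -> s \in c -> closed_trail s /\ c = circuit_of s.
Proof.
move=> /is_circuitP[t ct ->]; rewrite inE => ts; split.
  exact: same_closed_trail ts ct.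
exact: circuit_of_same.
Qed.

Lemma same_circuit_mem s t h :
  same_circuit s t -> (h \in t) || (mate h \in t) = (h \in s) || (mate h \in s).
Proof.
move=> /same_circuitP[k [->|->]]; rewrite !mem_rot // !mem_reverse mateK.
exact: orbC.
Qed.

Lemma on_circuit_of s h :
  closed_trail s -> on_circuit h (circuit_of s) = (h \in s) || (mate h \in s).
Proof.
move=> cs; apply/idP/idP => [/exists_inP[t]|].
  by rewrite inE => /same_circuit_mem <- ->.
have W t (ct : closed_trail t) : same_circuit s t -> h \in t ->
    on_circuit h (circuit_of s).
  by move=> st ht; apply/exists_inP; exists (Bseq (closed_trail_size ct));
    rewrite ?inE.
case/orP=> hs; first exact: (W _ cs (same_circuit_refl s)).
apply: (W _ (closed_trail_reverse cs) (same_circuit_reverse s)).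
by rewrite mem_reverse.
Qed.

End Trails.

(** * Circuit partitions as involutions on half-edges *)

Section CircuitPartitions.

Variable F : graph.
Implicit Types (g h : halfedge F) (s t u : seq (halfedge F)) (c : {set walk F}).
Implicit Types (P : {set {set walk F}}) (v w : vertex F).

Let mateK := @mateK F.
Let mate_inj : injective (@mate F) := inv_inj mateK.

(** Stated for bare sequences, so that rotations and reversals need no proof of the length bound in
    [walk]. *)
Definition trail_of P s := closed_trail s && (circuit_of s \in P).

Lemma trail_of_closed P s : trail_of P s -> closed_trail s.
Proof. by case/andP. Qed.

Lemma trail_of_same P s t : same_circuit s t -> trail_of P s -> trail_of P t.
Proof.
move=> st /andP[cs sP]; rewrite /trail_of -(circuit_of_same st) sP andbT.
exact: same_closed_trail st cs.
Qed.

Lemma trail_of_rot P n s : trail_of P s -> trail_of P (rot n s).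
Proof. exact/trail_of_same/same_circuit_rot. Qed.

Lemma trail_of_reverse P s : trail_of P s -> trail_of P (reverse s).
Proof. exact/trail_of_same/same_circuit_reverse. Qed.

Section OneCircuitPartition.

Variable P : {set {set walk F}}.
Hypothesis cP : circuit_partition P.

Lemma partition_circuit c : c \in P -> is_circuit c.
Proof. by case/andP: cP => /forall_inP H _; apply: H. Qed.

Lemma partition_inj h c c' : c \in P -> c' \in P ->
  on_circuit h c -> on_circuit h c' -> c = c'.
Proof.
case/andP: cP => _ /forallP/(_ h)/cards1P[d E] cinP c'inP hc hc'.
have: c \in [set c in P | on_circuit h c] by rewrite inE cinP.
have: c' \in [set c in P | on_circuit h c] by rewrite inE c'inP.
by rewrite E !inE => /eqP-> /eqP->.
Qed.

Lemma partition_ex h : exists2 c, c \in P & on_circuit h c.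
Proof.
case/andP: cP => _ /forallP/(_ h)/cards1P[d E].
by exists d; have: d \in [set d] by [rewrite inE]; rewrite -E inE => /andP[].
Qed.

Lemma trail_of_mem c (s : walk F) : c \in P -> s \in c -> trail_of P s.
Proof.
move=> cinP sc; have [cs E] := circuit_of_mem (partition_circuit cinP) sc.
by rewrite /trail_of cs -E.
Qed.

Lemma partitionP c : reflect (exists2 s, trail_of P s & c = circuit_of s) (c \in P).
Proof.
apply: (iffP idP) => [cinP|[s /andP[_ sP] -> //]].
have /is_circuitP[s cs E] := partition_circuit cinP.
by exists s; rewrite /trail_of -?E ?cs.
Qed.

Lemma trail_of_ex h : exists2 s, trail_of P s & h \in s.
Proof.
have [c cinP /exists_inP[s sc hs]] := partition_ex h.
by exists s => //; apply: trail_of_mem sc.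
Qed.

Lemma trail_of_circuit s t h : trail_of P s -> trail_of P t ->
  (h \in s) || (mate h \in s) -> (h \in t) || (mate h \in t) ->
  circuit_of s = circuit_of t.
Proof.
move=> /andP[cs sP] /andP[ct tP] hs ht.
by apply: (partition_inj (h := h)); rewrite ?on_circuit_of.
Qed.

Lemma circuit_of_eq s t : closed_trail t -> circuit_of s = circuit_of t -> same_circuit s t.
Proof.
move=> ct E; have: Bseq (closed_trail_size ct) \in circuit_of s.
  by rewrite E inE same_circuit_refl.
by rewrite inE.
Qed.

(** Both trails parametrize the circuit through [h]. A reversal is excluded because it would put
    both [h] and [mate h] on one closed trail. *)
Lemma trail_of_uniq s t h :
  trail_of P s -> trail_of P t -> h \in s -> h \in t -> exists n, t = rot n s.
Proof.
move=> Ps Pt hs ht.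
have E : circuit_of s = circuit_of t.
  by apply: (trail_of_circuit (h := h)) => //; rewrite ?hs ?ht.
have /same_circuitP[n [->|Et]] := circuit_of_eq (trail_of_closed Pt) E.
  by exists n.
have := closed_trail_mate (trail_of_closed Ps) hs.
by move: ht; rewrite Et mem_rot mem_reverse => ->.
Qed.

(* The trail through h is unique up to rotation, which does not affect [next]. *)
Definition succ h : halfedge F :=
  if [pick s : walk F | trail_of P s && (h \in val s)] is Some s
  then next s h else h.

Lemma succE s h : trail_of P s -> h \in s -> succ h = next s h.
Proof.
move=> Ps hs; rewrite /succ; case: pickP => [t /andP[Pt ht]|N].
  have [n ->] := trail_of_uniq Ps Pt hs ht.
  by rewrite next_rot // closed_trail_uniq // (trail_of_closed Ps).
by have := N (Bseq (closed_trail_size (trail_of_closed Ps))); rewrite /= Ps hs.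
Qed.

(** The half-edge paired with [h] by the passages of [P]: a trail arriving through [h] traverses its
    edge from [mate h]. Unlike [succ], this is an involution and records the transitions
    directly. *)
Definition turn h := succ (mate h).

Lemma turn_mate h : turn (mate h) = succ h.
Proof. by rewrite /turn mateK. Qed.

Lemma succ_turn h : succ h = turn (mate h).
Proof. by rewrite turn_mate. Qed.

(** The reversal of the trail through [mate h] makes the same passage in the opposite direction. *)
Lemma turnK : involutive turn.
Proof.
move=> h; have [s Ps hs] := trail_of_ex (mate h).
have us := closed_trail_uniq (trail_of_closed Ps).
rewrite /turn (succE Ps hs) (succE (trail_of_reverse Ps)).
  by rewrite next_reverse // mateK.
by rewrite mem_reverse mateK mem_next.
Qed.

Lemma turn_neq h : turn h != h.
Proof.
have [s Ps hs] := trail_of_ex (mate h).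
apply/eqP=> E; have := closed_trail_mate (trail_of_closed Ps) hs.
by rewrite mateK -E /turn (succE Ps hs) mem_next hs.
Qed.

Lemma inc_turn h : inc (turn h) = inc h.
Proof.
have [s Ps hs] := trail_of_ex (mate h).
by rewrite /turn (succE Ps hs) (closed_trail_next (trail_of_closed Ps) hs) mateK.
Qed.

Lemma passagesE v : passages P v = [set [set h; turn h] | h in star v].
Proof.
apply/setP=> p; rewrite inE; apply/idP/imsetP.
  case/exists_inP=> c cinP /exists_inP[s sc /existsP[h /and3P[hs iv /eqP->]]].
  have Ps := trail_of_mem cinP sc.
  by exists (mate h); rewrite ?inE // turn_mate (succE Ps hs).
case=> h; rewrite inE => iv ->.
have [s Ps hs] := trail_of_ex (mate h).
have cs := trail_of_closed Ps.
apply/exists_inP; exists (circuit_of s); first by case/andP: Ps.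
apply/exists_inP; exists (Bseq (closed_trail_size cs)).
  by rewrite inE same_circuit_refl.
apply/existsP; exists (mate h); rewrite /= hs mateK iv /=.
by rewrite -(succE Ps hs).
Qed.

Lemma fcycle_succ s : trail_of P s -> fcycle succ s.
Proof.
move=> Ps; have us := closed_trail_uniq (trail_of_closed Ps).
by apply: (cycle_from_next us) => h hs /=; rewrite (succE Ps hs).
Qed.

Lemma trail_of_orbit s :
  reflect (exists h, s = orbit succ h) (trail_of P s).
Proof.
apply: (iffP idP) => [Ps|[h ->]].
  have us := closed_trail_uniq (trail_of_closed Ps).
  case: s Ps us => [/trail_of_closed//|h s] Ps us; exists h.
  by rewrite (orbitE (fcycle_succ Ps) us (mem_head _ _)) /= eqxx rot0.
have [t Pt ht] := trail_of_ex h.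
rewrite (orbitE (fcycle_succ Pt) _ ht) ?trail_of_rot //.
exact: closed_trail_uniq (trail_of_closed Pt).
Qed.

End OneCircuitPartition.

(** [turn] determines [succ], and the trails of a circuit partition are exactly the orbits of
    [succ]. *)
Lemma turn_inj P Q : circuit_partition P -> circuit_partition Q ->
  turn P =1 turn Q -> P = Q.
Proof.
move=> cP cQ E.
have ES : succ P =1 succ Q by move=> h; rewrite !succ_turn.
have EO h : orbit (succ P) h = orbit (succ Q) h.
  rewrite /orbit; have -> : order (succ P) h = order (succ Q) h.
    exact/eq_card/(eq_fconnect ES).
  move: (order (succ Q) h) => n; elim: n h => //= n IH h; congr (_ :: _).
  by rewrite ES.
have ET s : trail_of P s = trail_of Q s.
  by apply/(trail_of_orbit cP)/(trail_of_orbit cQ) => -[h ->]; exists h.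
by apply/setP=> c; apply/(partitionP cP)/(partitionP cQ) => -[s Ts ->];
  exists s; rewrite // ?ET // -ET.
Qed.

(** * From a fixed-point-free involution at the vertices back to a circuit partition *)

Section FromTurn.

Variable f : halfedge F -> halfedge F.
Hypotheses (fK : involutive f) (f_neq : forall h, f h != h)
  (inc_f : forall h, inc (f h) = inc h).

Let next_of h := f (mate h).

Let next_of_inj : injective next_of.
Proof. exact: (inj_comp (inv_inj fK) mate_inj). Qed.

Let next_of_mate h : next_of (mate (next_of h)) = mate h.
Proof. by rewrite /next_of mateK fK. Qed.

(* mate \o (f \o mate)^n is a reflection of the dihedral group generated by f and
   mate, hence conjugate to one of these fixed-point-free involutions. *)
Lemma iter_turn_mate n h : iter n (fun h => f (mate h)) h != mate h.
Proof.
elim/ltn_ind: n h => -[|[|n]] IH h //=; first by rewrite eq_sym mate_neq.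
apply/eqP=> E.
have {E} E : iter n next_of (next_of h) = mate (next_of h).
  apply: next_of_inj; rewrite next_of_mate -E -iterSr.
  by [].
have := IH n (leqnSn _) (next_of h).
by rewrite -[iter _ _ _]/(iter n next_of (next_of h)) E eqxx.
Qed.

Let orbit_closed_trail h : closed_trail (orbit next_of h).
Proof.
apply/and3P; split.
- by rewrite -size_eq0 size_orbit -lt0n order_gt0.
- apply: sub_cycle (cycle_orbit next_of_inj h) => g k /= /eqP<-.
  by rewrite inc_f.
rewrite cat_uniq orbit_uniq map_inj_uniq // orbit_uniq andbT /=.
(* If an orbit met both halves of an edge, some iterate would send [g] to [mate g], which
   [iter_turn_mate] excludes. *)
apply/hasPn=> _ /mapP[g gh ->] /=; apply/negP=> gh'.
have: fconnect next_of g (mate g).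
  move: gh gh'; rewrite -!fconnect_orbit => gh; apply: connect_trans.
  by rewrite (fconnect_sym next_of_inj).
case/connectP=> p /fpathP[n ->]; rewrite last_traject => /esym/eqP.
exact/negP/iter_turn_mate.
Qed.

Let orbit_rot g h : g \in orbit next_of h -> exists n, orbit next_of g = rot n (orbit next_of h).
Proof.
move=> gh.
by have [n] := orbit_rot_cycle (cycle_orbit next_of_inj h) (orbit_uniq _ _) gh; exists n.
Qed.

(** [mate] conjugates [next_of] to its inverse, so a reversed orbit is again a cycle of [next_of].
    Hence the two halves of an edge yield the same circuit. *)
Let orbit_reverse g h :
  mate g \in orbit next_of h -> exists n, orbit next_of g = rot n (reverse (orbit next_of h)).
Proof.
move=> gh.
have cr : fcycle next_of (reverse (orbit next_of h)).
  rewrite /reverse rev_cycle cycle_map.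
  apply: sub_cycle (cycle_orbit next_of_inj h) => a b /= /eqP<-.
  by rewrite next_of_mate.
have [n] := orbit_rot_cycle cr (closed_trail_uniq (closed_trail_reverse (orbit_closed_trail h)))
  (etrans (mem_reverse _ _) gh).
by exists n.
Qed.

Definition turn_partition : {set {set walk F}} :=
  [set circuit_of (orbit (fun h => f (mate h)) h) | h in halfedge F].

Lemma turn_partition_circuit h : trail_of turn_partition (orbit next_of h).
Proof.
by rewrite /trail_of orbit_closed_trail imset_f.
Qed.

Lemma turn_partitionP : circuit_partition turn_partition.
Proof.
apply/andP; split.
  apply/forall_inP=> _ /imsetP[h _ ->]; apply/is_circuitP.
  by exists (orbit next_of h).
apply/forallP=> h; apply/cards1P; exists (circuit_of (orbit next_of h)).
apply/setP=> c; rewrite !inE; apply/andP/eqP => [[/imsetP[g _ ->]]|->]; last first.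
  by rewrite imset_f // on_circuit_of ?orbit_closed_trail // -fconnect_orbit connect0.
rewrite on_circuit_of ?orbit_closed_trail // => /orP[hg|hg];
  apply: circuit_of_same; apply/same_circuitP.
  by have [n ->] := orbit_rot hg; exists n; left.
by have [n ->] := orbit_reverse hg; exists n; right.
Qed.

Lemma turn_turn_partition : turn turn_partition =1 f.
Proof.
move=> h; rewrite /turn (succE turn_partitionP (turn_partition_circuit (mate h))) ?in_orbit //.
have := next_cycle (cycle_orbit next_of_inj (mate h)) (in_orbit _ _).
by move/eqP=> <-; rewrite /next_of mateK.
Qed.

End FromTurn.

End CircuitPartitions.

(** * Circuit partitions and transversals of the transitions *)

Section Transitions.

Variable F : graph.
Implicit Types (g h k : halfedge F) (t : transition F) (A : {set transition F}).
Implicit Types (P : {set {set walk F}}) (v w : vertex F).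

Lemma mem_star v h : (h \in star v) = (inc h == v).
Proof. by rewrite inE. Qed.

Definition pairing (f : halfedge F -> halfedge F) v : {set {set halfedge F}} :=
  [set [set h; f h] | h in star v].

Section Pairing.

Variable f : halfedge F -> halfedge F.
Hypotheses (fK : involutive f) (f_neq : forall h, f h != h)
  (inc_f : forall h, inc (f h) = inc h).

Lemma pairing_block v p h : p \in pairing f v -> h \in p -> p = [set h; f h].
Proof.
by case/imsetP=> k _ -> /set2P[]-> //; rewrite fK setUC.
Qed.

Lemma pairing_transition v : is_transition_at v (pairing f v).
Proof.
apply/andP; split; last first.
  by apply/forall_inP=> _ /imsetP[h _ ->]; rewrite cards2 (eq_sym h) f_neq.
apply/and3P; split.
- apply/eqP/setP=> h; rewrite mem_star; apply/bigcupP/eqP => [[p]|ih].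
    by case/imsetP=> k; rewrite mem_star => /eqP <- -> /set2P[]->; rewrite ?inc_f.
  exists [set h; f h]; last by rewrite set21.
  by apply/imsetP; exists h; rewrite ?mem_star ?ih.
- apply/trivIsetP=> p p' pP p'P; apply: contraR => /pred0Pn[h /= /andP[hp hp']].
  by rewrite (pairing_block pP hp) (pairing_block p'P hp').
- apply/imsetP=> -[h _ E].
  by have := set21 h (f h); rewrite -E inE.
Qed.

End Pairing.

(** The default [h] is returned only for half-edges that are not at the vertex of [t]. *)
Definition partner t h : halfedge F :=
  odflt h [pick k | (k != h) && ([set h; k] \in tpairs t)].

Lemma transition_block t p h k : p \in tpairs t -> h \in p -> k \in p ->
  k != h -> p = [set h; k].
Proof.
have [_ /forall_inP T] := andP (valP t) => /T/eqP cp hp kp kh.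
apply/eqP; rewrite eq_sym eqEcard cp cards2 eq_sym kh andbT.
by apply/subsetP=> g /set2P[]->.
Qed.

Lemma transition_blocks t p p' h : p \in tpairs t -> p' \in tpairs t ->
  h \in p -> h \in p' -> p = p'.
Proof.
have [/and3P[_ /trivIsetP T _] _] := andP (valP t) => pP p'P hp hp'.
apply/eqP; apply: contraTT isT => /(T _ _ pP p'P)/pred0P/(_ h) /=.
by rewrite hp hp'.
Qed.

Lemma partner_spec t h : inc h = tvertex t ->
  partner t h != h /\ [set h; partner t h] \in tpairs t.
Proof.
move=> ih; rewrite /partner; case: pickP => [k /andP[] //|N].
have: h \in star (tvertex t) by rewrite mem_star ih.
have [/and3P[/eqP T _ _] /forall_inP T2] := andP (valP t).
rewrite -[star _]T => /bigcupP[p pt hp].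
have := T2 p pt; rewrite (cardsD1 h) hp => /eqP[/eqP/cards1P[k E]].
have: k \in p :\ h by rewrite E set11.
rewrite in_setD1 => /andP[kh kp].
by have := N k; rewrite kh -(transition_block pt hp kp kh) pt.
Qed.

Lemma inc_block t p h : p \in tpairs t -> h \in p -> inc h = tvertex t.
Proof.
have [/and3P[/eqP T _ _] _] := andP (valP t).
move=> pt hp; apply/eqP; rewrite -mem_star -[star _]T.
by apply/bigcupP; exists p.
Qed.

Lemma partner_uniq t h k : [set h; k] \in tpairs t -> k != h -> partner t h = k.
Proof.
move=> hk kh; have [ph pt] := partner_spec (inc_block hk (set21 _ _)).
have E := transition_blocks pt hk (set21 _ _) (set21 _ _).
have: partner t h \in [set h; k] by rewrite -E set22.
by case/set2P=> // E'; rewrite E' eqxx in ph.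
Qed.

Lemma inc_partner t h : inc h = tvertex t -> inc (partner t h) = tvertex t.
Proof. by case/partner_spec=> _ /inc_block; apply; rewrite set22. Qed.

Lemma partnerK t h : inc h = tvertex t -> partner t (partner t h) = h.
Proof.
case/partner_spec=> n pt; apply: partner_uniq; first by rewrite setUC.
by rewrite eq_sym.
Qed.

Lemma tpairsE t : tpairs t = pairing (partner t) (tvertex t).
Proof.
apply/setP=> p; apply/idP/imsetP => [pt|[h]]; last first.
  by rewrite mem_star => /eqP/partner_spec[_ pt] ->.
have [_ /forall_inP T2] := andP (valP t).
have /cards2P[h [k [hk E]]] := T2 p pt; exists h.
  by rewrite mem_star (inc_block pt) ?E ?set21.
by rewrite E (@partner_uniq t h k) -?E // eq_sym.
Qed.

Lemma transition_inj t t' : tvertex t = tvertex t' -> tpairs t = tpairs t' -> t = t'.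
Proof.
move=> Ev Et; apply: val_inj; move: Ev Et; rewrite /tvertex /tpairs.
by case: (val t) (val t') => ? ? [? ?] /= -> ->.
Qed.

(** Once [x] is matched, only two points are left and they must be exchanged. Thus a transition is
    known from the partner of a single half-edge. *)
Lemma involution_on4 (T : finType) (S : {set T}) (f f' : T -> T) x :
  #|S| = 4 -> x \in S ->
  {in S, forall z, [/\ f z \in S, f (f z) = z & f z != z]} ->
  {in S, forall z, [/\ f' z \in S, f' (f' z) = z & f' z != z]} ->
  f x = f' x -> {in S, f =1 f'}.
Proof.
move=> S4 xS Hf Hf' E z zS.
have [->//|zx] := eqVneq z x.
have [->|zfx] := eqVneq z (f x).
  by have [_ -> _] := Hf _ xS; rewrite E; have [_ -> _] := Hf' _ xS.
have [fxS fxK fxn] := Hf _ xS.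
(* [a] is the fourth point, the only value left for [z] under either involution. *)
have /eqP/cards1P[a Ea] : #|S :\ x :\ f x :\ z| = 1.
  apply/eqP; rewrite -(eqn_add2l 3) -[3 + 1]/4 -S4.
  rewrite (cardsD1 x S) xS (cardsD1 (f x) (S :\ x)) !in_setD1 fxn fxS /=.
  by rewrite (cardsD1 z (S :\ x :\ f x)) !in_setD1 zfx zx zS.
have M u : {in S, forall z, [/\ u z \in S, u (u z) = z & u z != z]} ->
    u x = f x -> u z = a.
  move=> Hu Eu; have [uzS uzK uzn] := Hu _ zS.
  apply/set1P; rewrite -Ea !in_setD1 uzn uzS andbT /=.
  apply/andP; split.
    rewrite -Eu; apply: contraNneq zx => /(congr1 u).
    by rewrite uzK; have [_ -> _] := Hu _ xS => ->.
  by apply: contraNneq zfx => /(congr1 u); rewrite uzK Eu => ->.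
by rewrite (M f) // (M f').
Qed.

Lemma partner_star t : {in star (tvertex t), forall z,
  [/\ partner t z \in star (tvertex t), partner t (partner t z) = z & partner t z != z]}.
Proof.
move=> h; rewrite mem_star => /eqP ih.
by rewrite mem_star inc_partner // partnerK //; split=> //; case: (partner_spec ih).
Qed.

(** For a fixed half-edge [h] at [v], sending a transition to the partner of [h] is a bijection onto
    the other three half-edges. *)
Lemma card_transitions v : #|star v| = 4 -> #|[set t | tvertex t == v]| = 3.
Proof.
move=> S4; have /card_gt0P[h hv] : 0 < #|star v| by rewrite S4.
have <- : #|star v :\ h| = 3.
  by apply/eqP; rewrite -(eqn_add2l 1) -[1 + 3]/4 -S4 (cardsD1 h (star v)) hv.
have <- : [set partner t h | t in [set t | tvertex t == v]] = star v :\ h.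
  apply/setP=> k; rewrite in_setD1; apply/imsetP/andP => [[t]|[kh kv]].
    rewrite inE => /eqP tv ->; have [] := @partner_star t h; first by rewrite tv.
    by rewrite tv => -> _ ->.
  set p := [set h; k].
  have pS : p \subset star v by apply/subsetP=> g /set2P[]->.
  have cp : #|p| = 2 by rewrite cards2 (eq_sym h) kh.
  have cp' : #|star v :\: p| = 2 by rewrite cardsD (setIidPr pS) S4 cp.
  have Tt : is_transition_at v [set p; star v :\: p].
    apply/andP; split; last by apply/forall_inP=> q /set2P[]->; rewrite ?cp ?cp'.
    apply/and3P; split.
    - rewrite /cover bigcup_setU !big_set1; apply/eqP/setP=> g.
      rewrite in_setU in_setD; have := subsetP pS g.
      by case: (g \in p) => //= ->.
    - apply/trivIsetP=> q q' /set2P[]-> /set2P[]->; rewrite ?eqxx //= => _.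
        rewrite -setI_eq0; apply/eqP/setP=> g; rewrite in_setI in_setD in_set0.
        by case: (g \in p); rewrite ?andbF.
      rewrite -setI_eq0; apply/eqP/setP=> g; rewrite in_setI in_setD in_set0.
      by case: (g \in p); rewrite ?andbF.
    - by apply/set2P=> -[] E; rewrite -E cards0 in cp cp'.
  exists (exist _ (v, [set p; star v :\: p]) Tt); first by rewrite inE.
  by rewrite (@partner_uniq _ h k) // /tpairs /= set21.
rewrite card_in_imset // => t t'; rewrite !inE => /eqP tv /eqP t'v E.
apply: transition_inj; first by rewrite tv.
rewrite !tpairsE tv t'v; apply: eq_in_imset => g gv; congr [set _; _].
apply: (involution_on4 S4 hv _ _ E gv).
  by rewrite -tv; apply: partner_star.
by rewrite -t'v; apply: partner_star.
Qed.

Section PartitionTransitions.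

Variable P : {set {set walk F}}.
Hypothesis cP : circuit_partition P.

Lemma passages_transition v : is_transition_at v (passages P v).
Proof.
rewrite passagesE //; apply: pairing_transition.
- exact: turnK.
- exact: turn_neq.
- exact: inc_turn.
Qed.

Definition passage_transition v : transition F :=
  exist _ (v, passages P v) (passages_transition v).

Lemma partner_passage h : partner (passage_transition (inc h)) h = turn P h.
Proof.
apply: partner_uniq; last exact: turn_neq.
by rewrite /tpairs /= passagesE //; apply: imset_f; rewrite mem_star.
Qed.

End PartitionTransitions.

Definition transitions_of P : {set transition F} :=
  [set t | tpairs t == passages P (tvertex t)].

Definition transversal A := [forall v, #|[set t in A | tvertex t == v]| == 1].

Lemma transitions_ofE P (cP : circuit_partition P) :
  transitions_of P = [set passage_transition cP v | v : vertex F].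
Proof.
apply/setP=> t; rewrite inE; apply/eqP/imsetP => [E|[v _ ->] //].
by exists (tvertex t) => //; apply: transition_inj.
Qed.

Lemma transitions_of_inj :
  {in [set P | circuit_partition P] &, injective transitions_of}.
Proof.
move=> P Q; rewrite !inE => cP cQ E; apply: turn_inj => // h.
rewrite -partner_passage -(partner_passage cQ); congr partner.
apply: transition_inj => //.
have: passage_transition cP (inc h) \in transitions_of P by rewrite inE.
by rewrite E inE => /eqP.
Qed.

(** Conversely to reading off the transitions of a partition, the pairings chosen at the vertices
    combine into one involution [f], which [turn_partition] converts into circuits. *)
Lemma transversalP A :
  reflect (exists2 P, circuit_partition P & A = transitions_of P) (transversal A).
Proof.
apply: (iffP forallP) => [T|[P cP ->] v]; last first.
  apply/cards1P; exists (passage_transition cP v); apply/setP=> t.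
  rewrite transitions_ofE !inE; apply/andP/eqP => [[/imsetP[w _ ->] /eqP <-]|->] //.
  by rewrite imset_f.
have /fin_all_exists [a Ea] v : exists t, [set t in A | tvertex t == v] = [set t].
  exact/cards1P.
have av v : tvertex (a v) = v.
  by have := set11 (a v); rewrite -Ea inE => /andP[_ /eqP].
have aA t : t \in A -> t = a (tvertex t).
  by move=> tA; apply/set1P; rewrite -Ea inE tA eqxx.
pose f h := partner (a (inc h)) h.
have inc_f h : inc (f h) = inc h by rewrite /f inc_partner av.
have fK : involutive f by move=> h; rewrite {1}/f inc_f /f partnerK ?av.
have f_neq h : f h != h by have [] := @partner_spec (a (inc h)) h; rewrite ?av.
exists (turn_partition f); first exact: turn_partitionP.
have pE v : passages (turn_partition f) v = tpairs (a v).
  rewrite passagesE; last exact: turn_partitionP.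
  rewrite tpairsE av; apply: eq_in_imset => h; rewrite mem_star => /eqP <-.
  by rewrite turn_turn_partition.
apply/setP=> t; rewrite inE pE; apply/idP/eqP => [/aA {1}-> //|E].
have -> : t = a (tvertex t) by apply: transition_inj; rewrite ?av.
by have := set11 (a (tvertex t)); rewrite -Ea inE => /andP[].
Qed.

(** The predicate [q] on transitions is left arbitrary so that the undirected and the directed sums
    are both instances. *)
Lemma sum_transversals (W : nmodType) (q : {set {set halfedge F}} -> bool)
    (G : {set transition F} -> W) :
  (\sum_(P : {set {set walk F}} | circuit_partition P && [forall v, q (passages P v)])
     G (transitions_of P)
   = \sum_(A | transversal A && [forall t in A, q (tpairs t)]) G A)%R.
Proof.
have -> : (\sum_(A | transversal A && [forall t in A, q (tpairs t)]) G A
    = \sum_(A in transitions_of @: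
         [set P | circuit_partition P && [forall v, q (passages P v)]]) G A)%R.
  apply: eq_bigl => A; apply/andP/imsetP => [[/transversalP[P cP ->] /forall_inP H]|[P]].
    exists P => //; rewrite inE cP; apply/forallP=> v.
    by apply: (H (passage_transition cP v)); rewrite inE.
  rewrite inE => /andP[cP /forallP H] ->; split; first by apply/transversalP; exists P.
  by apply/forall_inP=> t; rewrite inE => /eqP->.
rewrite big_imset; first by apply: eq_bigl => P; rewrite inE.
by move=> P Q; rewrite !inE => /andP[cP _] /andP[cQ _]; apply: transitions_of_inj; rewrite inE.
Qed.

End Transitions.

(** * Jumps along Euler circuits *)

Lemma F2_addxx (a : 'F_2) : (a + a = 0)%R.
Proof. by case: a => -[|[|//]] ?; apply: val_inj. Qed.

Lemma F2_natr n : (n%:R = (odd n)%:R :> 'F_2)%R.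
Proof. by apply: val_inj; rewrite /= !val_Fp_nat //= !modn2 oddb. Qed.

Lemma F2_eq_sum0 (a b : 'F_2) : (a + b = 0)%R <-> a = b.
Proof.
split=> [E|->]; last exact: F2_addxx.
by rewrite -[a]addr0 -(F2_addxx b) addrA E add0r.
Qed.

Lemma sum_count (K : nzRingType) (I : finType) (r : seq I) (y : I -> K) :
  (\sum_(i <- r) y i = \sum_i (count_mem i r)%:R * y i)%R.
Proof.
elim: r => [|j r IH] /=.
  by rewrite big_nil big1 // => i _; rewrite mul0r.
rewrite big_cons IH; under [RHS]eq_bigr do rewrite natrD mulrDl.
rewrite big_split /=; congr (_ + _)%R; rewrite (bigD1 j) //= eqxx mul1r big1 ?addr0 // => i.
by rewrite eq_sym => /negPf->; rewrite mul0r.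
Qed.

(** * Alternation of two letters in cyclic words *)

Section AlternatingWords.

Variables (T : eqType) (v w : T).
Hypothesis vw : v != w.
Implicit Type u : seq T.

(* [interlaced] mentions one parametrization of the circuit; this closure of its
   pattern under rotation and reversal can be tested on any of them. *)
Definition alternating u :=
  filter (pred2 v w) u \in [:: [:: v; w; v; w]; [:: w; v; w; v]].

Lemma alternating_rot n u : alternating u -> alternating (rot n u).
Proof.
rewrite /alternating -{1}(cat_take_drop n u) /rot !filter_cat.
rewrite -[_ ++ filter _ (take _ _)]rot_size_cat.
move: (_ ++ _) => x; move: (size _) => m; rewrite !inE.
by case/orP=> /eqP->; case: m => [|[|[|[|[|m]]]]]; rewrite /rot /= ?eqxx ?orbT.
Qed.

Lemma alternating_rev u : alternating u -> alternating (rev u).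
Proof.
by rewrite /alternating filter_rev !inE => /orP[]/eqP->; rewrite /rev /= ?eqxx ?orbT.
Qed.

(** Two occurrences of each letter give the filtered word length 4, so a subsequence of length 4
    exhausts it. *)
Lemma alternating_subseq u : count_mem v u = 2 -> count_mem w u = 2 ->
  subseq [:: v; w; v; w] u -> alternating u.
Proof.
move=> cv cw sv; rewrite /alternating inE; apply/orP; left.
rewrite eq_sym -(size_subseq_leqif _).
  rewrite size_filter /=; apply/eqP.
  have := count_predUI (pred1 v) (pred1 w) u; rewrite cv cw.
  rewrite [count (predI _ _) u](_ : _ = 0) ?addn0 //.
  rewrite (eq_count (a2 := pred0)) ?count_pred0 // => x /=.
  by case: eqP => // ->; rewrite (negPf vw).
by rewrite subseq_filter sv /= !eqxx !orbT.
Qed.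

(** As the word starts with [v], only the pattern [v w v w] remains, and it puts exactly one [w] in
    [p]. *)
Lemma alternating_split p q : v \notin p -> v \notin q ->
  alternating (v :: p ++ v :: q) -> odd (count_mem w p).
Proof.
have F r : v \notin r -> filter (pred2 v w) r = nseq (count_mem w r) w.
  move=> vr; have -> : filter (pred2 v w) r = filter (pred1 w) r.
    apply: eq_in_filter => x xr /=; case: eqP => // E.
    by rewrite -E xr in vr.
  rewrite -size_filter; apply/all_pred1P.
  by apply/allP=> x; rewrite mem_filter => /andP[].
move=> vp vq; rewrite /alternating /= eqxx /= filter_cat /= eqxx /= !F // !inE.
case: (count_mem w p) => [|[|[|n]]] //=; rewrite !eqseq_cons (negPf vw) ?andbF //=.
by rewrite eq_sym (negPf vw) !andbF.
Qed.

End AlternatingWords.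

(** * Passages of an Euler system through a vertex *)

Section EulerSystems.

Variable F : graph.
Implicit Types (g h k : halfedge F) (s t u : seq (halfedge F)) (c : {set walk F}).
Implicit Types (v w : vertex F).

Let mateK := @mateK F.

Hypothesis F4 : four_regular F.

(** Each edge ends where the next one starts, so the list of end vertices is the list of start
    vertices shifted by one. *)
Lemma map_inc_mate s : closed_trail s -> map (fun h => inc (mate h)) s = rot 1 (map (@inc F) s).
Proof.
have path_inc h u : path (fun g l => inc (mate g) == inc l) h u ->
    map (fun g => inc (mate g)) (belast h u) = map (@inc F) u.
  by elim: u h => //= k u IH h /andP[/eqP-> /IH->].
case: s => // h s /and3P[_ /path_inc + _].
by rewrite belast_rcons /= rot1_cons -map_rcons.
Qed.

Variable C : {set {set walk F}}.
Hypothesis eC : euler_system C.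

Let cC : circuit_partition C. Proof. by case/andP: eC. Qed.

Lemma euler_same_circuit s t h k : trail_of C s -> trail_of C t ->
  inc h = inc k -> (h \in s) || (mate h \in s) -> (k \in t) || (mate k \in t) ->
  circuit_of s = circuit_of t.
Proof.
move=> Cs Ct ihk hs kt; case/andP: eC => _ /forallP/(_ (inc h))/cards1P[d E].
have M u l : trail_of C u -> inc h = inc l -> (l \in u) || (mate l \in u) -> circuit_of u = d.
  move=> Cu ihl lu; apply/set1P; rewrite -E inE; case/andP: Cu => cu ->.
  by apply/existsP; exists l; rewrite on_circuit_of // lu ihl connect0.
by rewrite (M s h) // (M t k).
Qed.

Lemma euler_star s h k : trail_of C s -> inc h = inc k ->
  (h \in s) || (mate h \in s) -> (k \in s) || (mate k \in s).
Proof.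
move=> Cs ihk hs; have [t Ct kt] := trail_of_ex cC k.
rewrite -on_circuit_of ?(trail_of_closed Cs) //.
rewrite (euler_same_circuit Cs Ct ihk hs) ?kt //.
by rewrite on_circuit_of ?(trail_of_closed Ct) // kt.
Qed.

Lemma turn_leave s h : trail_of C s -> h \in s -> turn C h = mate (prev s h).
Proof.
move=> Cs hs; rewrite -[RHS](turnK cC) turn_mate.
rewrite (succE cC Cs) ?mem_prev // next_prev //.
exact: closed_trail_uniq (trail_of_closed Cs).
Qed.

Lemma turn_enter s h : trail_of C s -> h \in s -> mate (turn C h) \in s.
Proof. by move=> Cs hs; rewrite (turn_leave Cs hs) mateK mem_prev. Qed.

Lemma turn_notin s h : trail_of C s -> h \in s -> turn C h \notin s.
Proof.
move=> Cs hs; rewrite -[turn C h]mateK.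
by rewrite closed_trail_mate ?turn_enter ?(trail_of_closed Cs).
Qed.

Lemma turn_leaving s h : trail_of C s -> mate h \in s -> turn C h \in s.
Proof. by move=> Cs hs; rewrite /turn (succE cC Cs hs) mem_next. Qed.

(** [turn C] exchanges the half-edges by which [s] leaves the vertex with those by which it enters,
    so half of the four leave. *)
Lemma card_leaving s h : trail_of C s -> h \in s ->
  #|[set k in star (inc h) | k \in s]| = 2.
Proof.
move=> Cs hs; set L := [set k in _ | _].
have LS : L \subset star (inc h) by apply/subsetP=> k; rewrite inE => /andP[].
have : #|star (inc h) :\: L| = #|L|.
  rewrite -(card_imset (mem L) (inv_inj (turnK cC))); apply: eq_card => k.
  rewrite !inE; apply/idP/imsetP => [/andP[nk ik]|[g]].
    exists (turn C k); last by rewrite turnK.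
    rewrite !inE inc_turn // ik; apply: turn_leaving => //.
    have := @euler_star s h k Cs (esym (eqP ik)); rewrite hs => /(_ isT).
    by move: nk; rewrite ik /= => /negPf ->.
  rewrite !inE => /andP[ig gs] ->; rewrite inc_turn // ig andbT /=.
  exact: turn_notin.
rewrite cardsD (setIidPr LS) F4; have := subset_leq_card LS; rewrite F4.
lia.
Qed.

Lemma count_vertex s v : trail_of C s -> v \in map (@inc F) s ->
  count_mem v (map (@inc F) s) = 2.
Proof.
move=> Cs /mapP[h hs ->]; rewrite count_map -size_filter.
rewrite -(card_leaving Cs hs) -(card_uniqP _).
  by apply: eq_card => k; rewrite mem_filter !inE.
by rewrite filter_uniq // closed_trail_uniq // (trail_of_closed Cs).
Qed.

(** A normal form for local computations: the circuit passes [v] twice, and is rotated to start at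
    one of these passages; [h] and [k] are the two half-edges leaving [v]. *)
Lemma euler_split v : exists h k p q,
  [/\ trail_of C (h :: p ++ k :: q), inc h = v, inc k = v,
      v \notin map (@inc F) p & v \notin map (@inc F) q].
Proof.
have /card_gt0P[h hv] : 0 < #|star v| by rewrite F4.
have ih : inc h = v by apply/eqP; rewrite -mem_star.
have [s Cs hs] := trail_of_ex cC h.
have [i r E] := rot_to hs.
have {}Cs : trail_of C (h :: r) by rewrite -E trail_of_rot.
have us : uniq (h :: r) := closed_trail_uniq (trail_of_closed Cs).
have := count_vertex Cs (map_f _ (mem_head _ _)).
rewrite ih /= ih eqxx add1n => -[c1].
have /mapP[k kr ik] : v \in map (@inc F) r by rewrite -has_pred1 has_count c1.
case/splitPr: kr Cs us c1 {E} => p q Cs us.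
rewrite map_cat count_cat /= -ik eqxx add1n addnS => -[/eqP].
rewrite addn_eq0 => /andP[/eqP cp /eqP cq].
by exists h, k, p, q; split; rewrite ?ih //; apply/count_memPn.
Qed.

Section Split.

Variables (h k : halfedge F) (p q : seq (halfedge F)).
Let v := inc h.
Let s := h :: p ++ k :: q.
Hypotheses (Cs : trail_of C s) (ik : inc k = v)
  (vp : v \notin map (@inc F) p) (vq : v \notin map (@inc F) q).

(** A vertex on the circuit occurs twice, so an odd count in [p] means once in [p] and once in [q].
    Parity is the form that a sum over ['F_2] can use. *)
Lemma interlaced_count w : v != w ->
  interlaced C v w = odd (count_mem w (map (@inc F) p)).
Proof.
move=> vw; have Es : map (@inc F) s = v :: map (@inc F) p ++ v :: map (@inc F) q.
  by rewrite /= map_cat /= ik.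
rewrite /interlaced vw /=; apply/idP/idP.
  case/exists_inP=> c cinC /exists_inP[t tc sub].
  have Ct := trail_of_mem cC cinC tc.
  have vt : v \in map (@inc F) (val t) by rewrite (mem_subseq sub) ?inE ?eqxx.
  have wt : w \in map (@inc F) (val t) by rewrite (mem_subseq sub) ?inE ?eqxx ?orbT.
  have alt := alternating_subseq vw (count_vertex Ct vt) (count_vertex Ct wt) sub.
  apply: (alternating_split vw vp vq); rewrite -Es.
  have /mapP[g gt ig] := vt.
  have E : circuit_of t = circuit_of s.
    apply: (euler_same_circuit Ct Cs (esym ig)); first by rewrite gt.
    by rewrite mem_head.
  have /same_circuitP[n [->|->]] := circuit_of_eq (trail_of_closed Cs) E.
    by rewrite map_rot; apply: alternating_rot.
  rewrite map_rot; apply: alternating_rot => //.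
  (* The reversed trail visits the vertices in reverse cyclic order, up to the shift of
     [map_inc_mate]. *)
  rewrite /reverse map_rev -map_comp; apply: alternating_rev => //.
  rewrite [map _ _](map_inc_mate (trail_of_closed Ct)).
  exact: alternating_rot.
move=> oddp.
have wp : w \in map (@inc F) p by rewrite -has_pred1 has_count; case: count oddp.
have ws : w \in map (@inc F) s by rewrite Es inE mem_cat wp orbT.
have wq : w \in map (@inc F) q.
  have := count_vertex Cs ws; rewrite Es /= count_cat /= (negPf vw) -has_pred1 has_count.
  case: (count _ (map _ q)) => //; rewrite !addn0 add0n => E; by rewrite E in oddp.
apply/exists_inP; exists (circuit_of s); first by case/andP: Cs.
apply/exists_inP; exists (Bseq (closed_trail_size (trail_of_closed Cs))).
  by rewrite inE same_circuit_refl.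
rewrite [map _ _]Es [subseq _ _]/= eqxx.
rewrite -[[:: w; v; w]]/([:: w] ++ [:: v; w]); apply: cat_subseq.
  by rewrite sub1seq.
by rewrite /= eqxx sub1seq.
Qed.

Variables (f : halfedge F -> 'F_2) (y : vertex F -> 'F_2).
Hypotheses (f_mate : forall g, f (mate g) = f g)
  (f_turn : forall g, (f g + f (turn C g) = y (inc g))%R).

(** Since [f] agrees on the two halves of an edge, passing from one half-edge to its successor
    changes [f] only by the jump at the vertex in between; these jumps telescope. *)
Lemma path_sum g u : fpath (succ C) g u ->
  (f (last g u) = f g + \sum_(l <- u) y (inc l))%R.
Proof.
elim: u g => [|l u IH] g /=; first by rewrite big_nil addr0.
case/andP=> /eqP <- /IH ->; rewrite big_cons addrA; congr (_ + _)%R.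
rewrite -f_turn -turn_mate turnK // f_mate.
by rewrite addrCA F2_addxx addr0.
Qed.

Lemma leaving_sum :
  (f h + f k = y v + \sum_w (interlaced C v w)%:R * y w)%R.
Proof.
have Ps : fpath (succ C) h (rcons p k).
  rewrite -cats1 cat_path /= andbT.
  have := fcycle_succ cC Cs; rewrite /s /= rcons_cat cat_path /=.
  by case/and3P=> -> ->.
have := path_sum Ps; rewrite last_rcons => ->.
rewrite addrA F2_addxx add0r -cats1 big_cat big_seq1 /= ik addrC; congr (_ + _)%R.
rewrite -(big_map (@inc F) predT) /=.
rewrite sum_count; apply: eq_bigr => w _; congr (_ * _)%R.
(* On the diagonal both coefficients vanish: [v] is not interlaced with itself and does not occur in
   [p]. *)
have [<-|vw] := eqVneq v w; last by rewrite interlaced_count //; exact: F2_natr.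
by rewrite /interlaced eqxx (count_memPn vp).
Qed.

End Split.

End EulerSystems.

(** * The circuit-nullity formula *)

Section Counting.

Variable F : graph.
Implicit Types (g h k : halfedge F) (s t u : seq (halfedge F)) (c : {set walk F}).
Implicit Types (v w : vertex F).

Let mateK := @mateK F.

(** Edge functions constant on every circuit of [P]: invariance under [mate] and [turn P] propagates
    a value along a whole trail. *)
Definition invariant_functions (P : {set {set walk F}}) :
    {set {ffun halfedge F -> 'F_2}} :=
  [set f : {ffun halfedge F -> 'F_2} |
    [forall h, (f (mate h) == f h) && (f (turn P h) == f h)]].

Definition component_functions : {set {ffun halfedge F -> 'F_2}} :=
  [set f : {ffun halfedge F -> 'F_2} | [forall h, (f (mate h) == f h) &&
     [forall k, (inc k == inc h) ==> (f k == f h)]]].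

Lemma F2_bool (b : bool) : ((b%:R : 'F_2) == 1)%R = b.
Proof. by case: b. Qed.

Lemma F2_eq1 (a : 'F_2) : ((a == 1)%:R = a)%R.
Proof. by case: a => -[|[|//]] ?; apply: val_inj. Qed.

Lemma invariant_trail P (T : Type) (f : halfedge F -> T) s h k :
  circuit_partition P ->
  (forall g, f (mate g) = f g) -> (forall g, f (turn P g) = f g) ->
  trail_of P s -> h \in s -> k \in s -> f h = f k.
Proof.
move=> cP fm ft Ps hs ks.
have us := closed_trail_uniq (trail_of_closed Ps).
have fs g : f (succ P g) = f g by rewrite -turn_mate ft fm.
have: k \in orbit (succ P) h.
  by rewrite (orbitE (fcycle_succ cP Ps) us hs) mem_rot.
rewrite -fconnect_orbit => /connectP[u + ->]; elim: u h {hs} => //= g u IH h.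
by case/andP=> /eqP <- /IH <-.
Qed.

(** Such a function is the indicator of the set of circuits on which it takes the value 1. *)
Lemma card_invariant_functions P : circuit_partition P ->
  #|invariant_functions P| = 2 ^ #|P|.
Proof.
move=> cP; rewrite -card_powerset.
pose fB (B : {set {set walk F}}) : {ffun halfedge F -> 'F_2} :=
  [ffun h => ([exists c in B, on_circuit h c])%:R]%R.
have fBE (B : {set {set walk F}}) s h : B \subset P -> trail_of P s -> h \in s ->
    [exists c in B, on_circuit h c] = (circuit_of s \in B).
  move=> BP Ps hs; have cs := trail_of_closed Ps.
  apply/exists_inP/idP => [[c cB hc]|sB]; last first.
    by exists (circuit_of s); rewrite ?on_circuit_of ?hs.
  suff <- : c = circuit_of s by [].
  apply: (partition_inj cP (h := h)); rewrite ?on_circuit_of ?hs //.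
    exact: (subsetP BP).
  by case/andP: Ps.
have fBE' (B : {set {set walk F}}) s h : B \subset P -> trail_of P s -> mate h \in s ->
    [exists c in B, on_circuit h c] = (circuit_of s \in B).
  move=> BP Ps hs.
  rewrite (circuit_of_same (same_circuit_reverse s)).
  by rewrite (fBE B (reverse s) h) ?trail_of_reverse // mem_reverse.
have <- : fB @: powerset P = invariant_functions P.
  apply/setP=> f; apply/imsetP/idP => [[B]|].
    rewrite inE => BP ->; rewrite inE; apply/forallP=> h; rewrite !ffunE.
    have [s Ps hs] := trail_of_ex cP (mate h).
    rewrite (fBE B s (mate h)) // (fBE' B s h) // (fBE B s (turn P h)) ?eqxx //.
    by rewrite /turn (succE cP Ps hs) mem_next.
  rewrite inE => /forallP H.
  have fm h : f (mate h) = f h by case/andP: (H h) => /eqP.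
  have ft h : f (turn P h) = f h by case/andP: (H h) => _ /eqP.
  exists [set c in P | [exists h, on_circuit h c && (f h == 1%R)]].
    by rewrite inE; apply/subsetP=> c; rewrite inE => /andP[].
  apply/ffunP=> h; rewrite !ffunE.
  have [s Ps hs] := trail_of_ex cP h; have cs := trail_of_closed Ps.
  rewrite (fBE _ s) //; last by apply/subsetP=> c; rewrite inE => /andP[].
  rewrite -[LHS]F2_eq1; congr ((nat_of_bool _)%:R)%R; rewrite inE.
  have -> /= : circuit_of s \in P by case/andP: Ps.
  apply/idP/existsP => [fh|[k]].
    by exists h; rewrite on_circuit_of // hs.
  rewrite on_circuit_of // => /andP[ks /eqP fk]; apply/eqP; rewrite -fk.
  case/orP: ks => ks; first exact: (invariant_trail cP fm ft Ps hs ks).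
  by rewrite -(fm k); apply: (invariant_trail cP fm ft Ps hs ks).
apply: card_in_imset => B B'; rewrite !inE => BP B'P E.
have M c : c \in P -> (c \in B) = (c \in B').
  case/(partitionP cP)=> s Ps ->.
  have [h hs] : exists h, h \in s.
    by case: s Ps => [/trail_of_closed//|h s _]; exists h; rewrite mem_head.
  have : fB B h = fB B' h by rewrite E.
  rewrite !ffunE => /(congr1 (fun a : 'F_2 => a == 1%R)).
  by rewrite !F2_bool !(fBE _ s h).
apply/setP=> c; apply/idP/idP => cB; first by rewrite -M // (subsetP BP).
by rewrite M // (subsetP B'P).
Qed.

Lemma adjacent_sym : connect_sym (@adjacent F).
Proof.
apply: sym_connect_sym => v w; apply/existsP/existsP => -[h /andP[hv hw]];
  by exists (mate h); rewrite mateK hv hw.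
Qed.

(** Components are represented by their roots, and a function is the indicator of a set of roots. An
    isolated vertex would be a component that no function on half-edges detects, whence the
    hypothesis on stars. *)
Lemma card_component_functions : (forall v, 0 < #|star v|) ->
  #|component_functions| = 2 ^ ncomponents F.
Proof.
move=> star_gt0.
pose R : {set vertex F} := [set v | roots (@adjacent F) v].
have -> : ncomponents F = #|R|.
  by apply: eq_card => v; rewrite !inE andbT.
rewrite -card_powerset.
pose fB (B : {set vertex F}) : {ffun halfedge F -> 'F_2} :=
  [ffun h => (fingraph.root (@adjacent F) (inc h) \in B)%:R]%R.
have rootE h : fingraph.root (@adjacent F) (inc (mate h)) = fingraph.root (@adjacent F) (inc h).
  apply/(fingraph.rootP adjacent_sym); rewrite adjacent_sym; apply: connect1.
  by apply/existsP; exists h; rewrite !eqxx.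
have <- : fB @: powerset R = component_functions.
  apply/setP=> f; apply/imsetP/idP => [[B]|].
    rewrite inE => BP ->; rewrite inE; apply/forallP=> h; rewrite !ffunE rootE eqxx /=.
    by apply/forall_inP=> k /eqP E; rewrite !ffunE E.
  rewrite inE => /forallP H.
  have fm h : f (mate h) = f h by case/andP: (H h) => /eqP.
  have fi h k : inc k = inc h -> f k = f h.
    by case/andP: (H h) => _ /forall_inP/(_ k) + /eqP E => /(_ E) /eqP.
  have fc h k : connect (@adjacent F) (inc h) (inc k) -> f h = f k.
    case/connectP=> u; elim: u h => /= [|w u IH] h; first by move=> _ /fi ->.
    case/andP=> /existsP[g /andP[/eqP gh /eqP gw]] pu E.
    by rewrite -(fi h g) // -fm; apply: IH; rewrite gw.
  exists [set v in R | [exists h, (inc h == v) && (f h == 1%R)]].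
    by rewrite inE; apply/subsetP=> v; rewrite inE => /andP[].
  apply/ffunP=> h; rewrite !ffunE !inE roots_root /=; last exact: adjacent_sym.
  rewrite -[LHS]F2_eq1; congr ((nat_of_bool _)%:R)%R.
  apply/idP/existsP => [fh|[k /andP[/eqP ik fk]]].
    have /card_gt0P[k] := star_gt0 (fingraph.root (@adjacent F) (inc h)).
    rewrite inE => ik; exists k; rewrite ik /= -(fc h k) //.
    by rewrite (eqP ik) connect_root.
  by rewrite (fc h k) // ik connect_root.
apply: card_in_imset => B B'; rewrite !inE => BP B'P E.
have M v : v \in R -> (v \in B) = (v \in B').
  rewrite inE => /eqP rv; have /card_gt0P[h] := star_gt0 v.
  rewrite inE => /eqP ih.
  have : fB B h = fB B' h by rewrite E.
  rewrite !ffunE => /(congr1 (fun a : 'F_2 => a == 1%R)).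
  by rewrite !F2_bool ih rv.
apply/setP=> v; apply/idP/idP => vB; first by rewrite -M // (subsetP BP).
by rewrite M // (subsetP B'P).
Qed.

End Counting.

(** * Potentials with prescribed jumps, and compatibility at a vertex *)

Section EulerCounting.

Variable F : graph.
Implicit Types (g h k : halfedge F) (s t u : seq (halfedge F)) (c : {set walk F}).
Implicit Types (v w : vertex F).

Let mateK := @mateK F.
Let mate_inj : injective (@mate F) := inv_inj mateK.

Hypothesis F4 : four_regular F.
Variable C : {set {set walk F}}.
Hypothesis eC : euler_system C.

Let cC : circuit_partition C. Proof. by case/andP: eC. Qed.

Lemma leave_or_enter s h : trail_of C s ->
  (turn C h \in s) || (mate (turn C h) \in s) = (h \in s) || (mate h \in s).
Proof.
move=> Cs; have E := inc_turn cC h.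
by apply/idP/idP; apply: (euler_star eC Cs); rewrite ?E.
Qed.

Section Potential.

Variable y : vertex F -> 'F_2.

(* Any trail through h or its mate will do, provided that it is the same for all
   half-edges of the circuit, whence the use of [pick]. *)
Definition base h : walk F :=
  odflt [bseq]
    [pick s : walk F | trail_of C s && ((h \in val s) || (mate h \in val s))].

Lemma base_spec h :
  trail_of C (val (base h)) /\ (h \in val (base h)) || (mate h \in val (base h)).
Proof.
rewrite /base; case: pickP => [s /andP[] //|N].
have [s Cs hs] := trail_of_ex cC h.
by have := N (Bseq (closed_trail_size (trail_of_closed Cs))); rewrite /= Cs hs.
Qed.

Lemma base_mate h : base (mate h) = base h.
Proof.
by rewrite /base; congr odflt; apply: eq_pick => s; rewrite mateK [X in _ && X]orbC.
Qed.

Lemma base_turn h : base (turn C h) = base h.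
Proof.
rewrite /base; congr odflt; apply: eq_pick => s /=.
by case Cs: (trail_of C s) => //=; rewrite leave_or_enter.
Qed.

(** A discrete antiderivative of [y] along the circuit. The partial sum includes the jump at the
    vertex from which the edge of [h] is traversed, whence the [.+1]. *)
Definition potential h : 'F_2 :=
  (\sum_(k <- take (index (if h \in val (base h) then h else mate h) (val (base h))).+1
                   (val (base h))) y (inc k))%R.

Lemma potential_mate h : potential (mate h) = potential h.
Proof.
rewrite /potential base_mate mateK; have [Cs] := base_spec h.
have cs := trail_of_closed Cs.
have [hs _|hs /= mhs] := boolP (h \in _); last by rewrite mhs.
by rewrite (negPf (closed_trail_mate cs hs)).
Qed.

(** Every vertex of the circuit is passed twice, so its contributions cancel. This lets the
    potential close up around the circuit. *)
Lemma euler_sum0 s : trail_of C s -> (\sum_(k <- s) y (inc k) = 0)%R.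
Proof.
move=> Cs; rewrite -(big_map (@inc F) predT) /= sum_count big1 // => v _.
have [vs|/count_memPn ->] := boolP (v \in map (@inc F) s); last by rewrite mul0r.
by rewrite (count_vertex F4 eC Cs) // mulr2n F2_addxx mul0r.
Qed.

Lemma potential_turn h : (potential h + potential (turn C h) = y (inc h))%R.
Proof.
(* The equation is symmetric in [h] and [turn C h], one of which leaves the vertex on the base
   trail. *)
wlog hs : h / h \in val (base h) => [W|].
  have [Cs /orP[|hs]] := base_spec h; first exact: W.
  have := W (turn C h); rewrite turnK // inc_turn // addrC; apply.
  by rewrite base_turn turn_leaving.
have [Cs _] := base_spec h; have us := closed_trail_uniq (trail_of_closed Cs).
suff H g : g \in val (base h) -> succ C g = h ->
    (\sum_(k <- take (index h (val (base h))).+1 (val (base h))) y (inc k) +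
     \sum_(k <- take (index g (val (base h))).+1 (val (base h))) y (inc k) = y (inc h))%R.
  rewrite -(H (mate (turn C h))) ?turn_enter //; last by rewrite succ_turn mateK turnK.
  rewrite -[potential (turn C h)]potential_mate /potential hs.
  by rewrite base_mate base_turn turn_enter.
move: (val (base h)) hs Cs us => s hs Cs us.
have := fcycle_succ cC Cs; have := euler_sum0 Cs.
have succ_inj : injective (succ C).
  move=> a b; rewrite !succ_turn => E; apply: mate_inj.
  exact: (inv_inj (turnK cC)) E.
(* If [h] comes first, its predecessor is the last half-edge, whose partial sum is the vanishing
   total. Otherwise the two partial sums differ by one term. *)
case/splitPr: hs us {Cs} => p q; case/lastP: p => [|p l] us E0.
  rewrite cat0s [fcycle _ _]/= rcons_path => /andP[_ /eqP El] gs Eg.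
  have -> : g = last h q by apply: succ_inj; rewrite Eg.
  rewrite index_last // (take_size (h :: q)) E0 addr0.
  by rewrite /= eqxx take0 big_seq1.
rewrite cat_rcons => Ec gs Eg.
have El : succ C l = h.
  move: Ec; case: (p) => [|a p'] /=; first by case/andP=> /eqP.
  by rewrite rcons_path cat_path /= => /andP[/and3P[_ _ /andP[/eqP]]].
have -> : g = l by apply: succ_inj; rewrite Eg.
move: us; rewrite cat_rcons cat_uniq /= => /and3P[_ /norP[lp /norP[hp _]] /andP[lh _]].
move: lh; rewrite inE => /norP[lh _].
rewrite !index_cat (negPf lp) (negPf hp) /= !eqxx (negPf lh) addn0 addn1.
have -> : take (size p).+1 (p ++ l :: h :: q) = rcons p l.
  by rewrite -cat_rcons take_size_cat ?size_rcons.
have -> : take (size p).+2 (p ++ l :: h :: q) = rcons (rcons p l) h.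
  by rewrite -!cat_rcons take_size_cat ?size_rcons.
by rewrite -[rcons _ h]cats1 big_cat big_seq1 /= addrAC F2_addxx add0r.
Qed.

End Potential.

Definition interlace_sum (y : vertex F -> 'F_2) v : 'F_2 :=
  (\sum_w (interlaced C v w)%:R * y w)%R.

Lemma turn_star P : circuit_partition P -> forall v, {in star v, forall z,
  [/\ turn P z \in star v, turn P (turn P z) = z & turn P z != z]}.
Proof.
move=> cP v z; rewrite !mem_star => /eqP zv.
by rewrite inc_turn // zv turnK // turn_neq.
Qed.

(** By [involution_on4], agreement at the single half-edge [h] makes the two transitions at its
    vertex equal. *)
Lemma is_phiE P (cP : circuit_partition P) h :
  is_phi C (passage_transition cP (inc h)) = (turn P h == turn C h).
Proof.
rewrite /is_phi /tpairs /tvertex /=; apply/eqP/eqP => [E|E].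
  rewrite -(partner_passage cP) -(partner_passage cC); congr partner.
  exact: transition_inj.
rewrite !passagesE //; apply: eq_in_imset => k ks; congr [set _; _].
by apply: (involution_on4 (F4 (inc h)) _ _ _ E ks); rewrite ?mem_star //; apply: turn_star.
Qed.

Section Vertex.

Variables (P : {set {set walk F}}) (h k : halfedge F) (p q : seq (halfedge F)).
Hypothesis cP : circuit_partition P.
Let v := inc h.
Let s := h :: p ++ k :: q.
Hypotheses (Cs : trail_of C s) (ik : inc k = v)
  (vp : v \notin map (@inc F) p) (vq : v \notin map (@inc F) q).

Let hs : h \in s. Proof. exact: mem_head. Qed.
Let ks : k \in s. Proof. by rewrite inE mem_cat mem_head !orbT. Qed.

Let hk : h != k.
Proof.
have /= /andP[+ _] := closed_trail_uniq (trail_of_closed Cs).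
by apply: contraNneq => ->; rewrite mem_cat mem_head orbT.
Qed.

Lemma star_enum : uniq [:: h; k; turn C h; turn C k].
Proof.
have N x z : x \in s -> z \in s -> x != turn C z.
  by move=> xs zs; apply: contraNneq (turn_notin eC Cs zs) => <-.
by rewrite /= !inE !negb_or !(N h) // !(N k) // (inj_eq (inv_inj (turnK cC))) hk.
Qed.

Lemma mem_star_enum g : (g \in star v) = (g \in [:: h; k; turn C h; turn C k]).
Proof.
have S : [set x in [:: h; k; turn C h; turn C k]] \subset star v.
  by apply/subsetP=> x; rewrite inE mem_star !inE; case/or4P=> /eqP ->; rewrite ?inc_turn // ik.
have /eqP <- : [set x in [:: h; k; turn C h; turn C k]] == star v.
  by rewrite eqEcard S F4 cardsE (card_uniqP star_enum).
by rewrite inE.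
Qed.

Lemma turn_rest (a b c d : halfedge F) : uniq [:: a; b; c; d] ->
  [:: a; b; c; d] =i [:: h; k; turn C h; turn C k] -> turn P a = b -> turn P c = d.
Proof.
move=> U M Eab.
have Sc : c \in star v by rewrite mem_star_enum -M !inE eqxx !orbT.
have [Pc PcK Pn] := turn_star cP Sc.
move: Pc; rewrite mem_star_enum -M !inE (negPf Pn) /=.
move: U; rewrite /= !inE !negb_or -!andbA => /and5P[_ ac _ bc _].
case/or3P=> /eqP // E; move: PcK.
  by rewrite E Eab => E'; rewrite E' eqxx in bc.
by rewrite E -Eab turnK // => E'; rewrite E' eqxx in ac.
Qed.

(** Here [h] and [k] leave [v], while [turn C h] and [turn C k] enter. The cases are the three
    possible partners of [h]. *)
Variant turn_case : bool -> bool -> Type :=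
| TurnPhi of turn P h = turn C h & turn P k = turn C k : turn_case true false
| TurnChi of turn P h = turn C k & turn P k = turn C h : turn_case false true
| TurnPsi of turn P h = k & turn P (turn C h) = turn C k : turn_case false false.

(** Both [h] and [k] leave [v] along [s]. Every parametrization of the circuit is a rotation of [s]
    or of its reversal, so none has one of them entering and the other leaving. *)
Lemma is_chi_not_psi (t := passage_transition cP v) : is_chi C t -> turn P h != k.
Proof.
case/andP=> _ /exists_inP[c cinC /exists_inP[r rc /forall_inP H]].
apply/eqP=> E.
have hkt : [set h; k] \in tpairs t.
  by rewrite /tpairs /= passagesE // -E; apply: imset_f; rewrite mem_star.
have /existsP[g /existsP[l /and3P[gr lr /eqP E2]]] := H _ hkt.
have Cr := trail_of_mem cC cinC rc.
have sub z : z \in [set mate g; l] -> z \in s by rewrite -E2 => /set2P[]->.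
have ls : l \in s by rewrite sub ?set22.
have gs : mate g \in s by rewrite sub ?set21.
have /same_circuitP[n [En|En]] : same_circuit s r.
  apply: circuit_of_eq (trail_of_closed Cr) _.
  by apply: (trail_of_circuit cC Cs Cr (h := l)); rewrite ?ls ?lr.
  move: gr; rewrite (En : val r = _) mem_rot => /(closed_trail_mate (trail_of_closed Cs)).
  by rewrite gs.
move: lr; rewrite (En : val r = _) mem_rot mem_reverse => lr.
by have := closed_trail_mate (trail_of_closed Cs) ls; rewrite lr.
Qed.

Lemma is_chi_crossing (t := passage_transition cP v) :
  turn P h = turn C k -> turn P k = turn C h -> is_chi C t.
Proof.
move=> Eh Ek; apply/andP; split.
  rewrite is_phiE Eh (inj_eq (inv_inj (turnK cC))) eq_sym; exact: hk.
apply/exists_inP; exists (circuit_of s); first by case/andP: Cs.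
apply/exists_inP; exists (Bseq (closed_trail_size (trail_of_closed Cs))).
  by rewrite inE same_circuit_refl.
apply/forall_inP=> b; rewrite /tpairs /= passagesE // => /imsetP[g gv ->].
have W x z : x \in s -> z \in s -> turn C z = turn P x ->
    [exists a, exists l, [&& a \in s, l \in s & [set x; turn P x] == [set mate a; l]]].
  move=> xs zs E; apply/existsP; exists (mate (turn C z)); apply/existsP; exists x.
  by rewrite turn_enter // xs mateK E setUC eqxx.
move: gv; rewrite mem_star_enum !inE => /or4P[]/eqP->.
- exact: (W h k).
- exact: (W k h).
- by rewrite -Ek turnK // setUC; apply: (W k h).
- by rewrite -Eh turnK // setUC; apply: (W h k).
Qed.

Lemma turnP (t := passage_transition cP v) : turn_case (is_phi C t) (is_chi C t).
Proof.
have U := star_enum.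
have [/eqP E|N] := boolP (turn P h == turn C h).
  have -> : is_phi C t = true by rewrite is_phiE E eqxx.
  have -> : is_chi C t = false by rewrite /is_chi is_phiE E eqxx.
  constructor=> //; apply: (turn_rest (a := h) (b := turn C h)) => //.
    rewrite -(perm_uniq (_ : perm_eq [:: h; k; turn C h; turn C k] _)) //.
    by rewrite perm_cons -[[:: k; _; _]]/([:: k] ++ [:: _] ++ [:: _]) perm_catCA.
  by move=> x; rewrite !inE; do !case: (_ == _).
have phiF : is_phi C t = false by rewrite is_phiE (negPf N).
rewrite phiF; have [/eqP E|N'] := boolP (turn P h == k).
  have -> : is_chi C t = false by apply/negP=> /is_chi_not_psi; rewrite E eqxx.
  constructor=> //.
  by apply: (turn_rest (a := h) (b := k)).
have E : turn P h = turn C k.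
  have hv : h \in star v by rewrite mem_star.
  have [+ _ Pn] := turn_star cP hv.
  by rewrite mem_star_enum !inE (negPf Pn) (negPf N) (negPf N') => /eqP.
have E' : turn P k = turn C h.
  apply: (turn_rest (a := h) (b := turn C k)) => //.
    rewrite -(perm_uniq (_ : perm_eq [:: h; k; turn C h; turn C k] _)) //.
    rewrite perm_cons -[[:: k; _; _]]/([:: k; turn C h] ++ [:: _]).
    by rewrite perm_catC.
  by move=> x; rewrite !inE; do !case: (_ == _).
have -> : is_chi C t = true by apply: is_chi_crossing.
by constructor.
Qed.

Section Jump.

Variable f : halfedge F -> 'F_2.
Hypothesis f_mate : forall g, f (mate g) = f g.

(** Both jumps of [f] vanish for phi; for chi they have the same two terms crosswise, and for psi
    the same terms in parallel. *)
Lemma jump_const : (forall g, f (turn P g) = f g) ->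
  forall g, g \in star v -> (f g + f (turn C g) = f h + f (turn C h))%R.
Proof.
move=> fP; have E : (f k + f (turn C k) = f h + f (turn C h))%R.
  case: turnP => E1 E2.
  - by rewrite -E1 -E2 !fP !F2_addxx.
  - by rewrite -E1 -E2 !fP addrC.
  - by rewrite -E2 fP -E1 fP.
move=> g; rewrite mem_star_enum !inE => /or4P[]/eqP-> //.
  by rewrite turnK // addrC.
by rewrite turnK // addrC.
Qed.

Variable y : vertex F -> 'F_2.
Hypothesis f_turn : forall g, (f g + f (turn C g) = y (inc g))%R.

(** The pairings of phi, chi and psi amount to [y v = 0], [f h + f k = y v] and [f h = f k]. The
    identity of [leaving_sum] turns the last two into conditions on [interlace_sum]. *)
Lemma compatible_jump (t := passage_transition cP v) :
  (forall g, g \in star v -> f (turn P g) = f g) <->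
  (if is_phi C t then y v
   else if is_chi C t then interlace_sum y v else y v + interlace_sum y v)%R = 0%R.
Proof.
have yv := f_turn h; have := f_turn k; rewrite ik -/v => yk.
have yI := leaving_sum F4 eC Cs ik vp vq f_mate f_turn.
rewrite -/(interlace_sum y v) in yI.
have -> : interlace_sum y v = (f h + f k + y v)%R.
  by rewrite yI addrC addrA F2_addxx add0r.
rewrite /v -/v in yv *.
have R (a b c d : halfedge F) : uniq [:: a; b; c; d] ->
    [:: a; b; c; d] =i [:: h; k; turn C h; turn C k] ->
    turn P a = b -> turn P c = d ->
    (forall g, g \in star v -> f (turn P g) = f g) <-> f b = f a /\ f d = f c.
  move=> U M Eab Ecd; split=> [H|[H1 H2] g].
    by rewrite -Eab -Ecd; split; apply: H; rewrite mem_star_enum -M !inE eqxx ?orbT.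
  rewrite mem_star_enum -M !inE => /or4P[]/eqP->; rewrite ?Eab ?Ecd //.
    by rewrite -Eab turnK // Eab.
  by rewrite -Ecd turnK // Ecd.
have U := star_enum.
have U1 : uniq [:: h; turn C h; k; turn C k].
  rewrite -(perm_uniq (_ : perm_eq [:: h; k; turn C h; turn C k] _)) //.
  by rewrite perm_cons -[[:: k; _; _]]/([:: k] ++ [:: _] ++ [:: _]) perm_catCA.
have U2 : uniq [:: h; turn C k; k; turn C h].
  rewrite -(perm_uniq (_ : perm_eq [:: h; k; turn C h; turn C k] _)) //.
  rewrite perm_cons -[[:: k; _; _]]/([:: k; turn C h] ++ [:: _]).
  by rewrite perm_catC.
have eh : f (turn C h) = (f h + y v)%R by rewrite -yv addrA F2_addxx add0r.
have ek : f (turn C k) = (f k + y v)%R by rewrite -yk addrA F2_addxx add0r.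
have M1 : [:: h; turn C h; k; turn C k] =i [:: h; k; turn C h; turn C k].
  by move=> x; rewrite !inE; do !case: (_ == _).
have M2 : [:: h; turn C k; k; turn C h] =i [:: h; k; turn C h; turn C k].
  by move=> x; rewrite !inE; do !case: (_ == _).
case: turnP => E1 E2.
- apply: (iff_trans (R _ _ _ _ U1 M1 E1 E2)); rewrite eh ek.
  split=> [[E _]|->]; last by rewrite !addr0.
  by apply: (addrI (f h)); rewrite E addr0.
- apply: (iff_trans (R _ _ _ _ U2 M2 E1 E2)); rewrite eh ek.
  split=> [[<- _]|E].
    by rewrite -addrA F2_addxx.
  split; first by apply/esym/F2_eq_sum0; rewrite addrA.
  by apply/F2_eq_sum0; rewrite -E; rewrite addrAC.
- apply: (iff_trans (R _ _ _ _ U (fun=> erefl) E1 E2)); rewrite eh ek.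
  rewrite [X in X = 0%R]addrC -addrA F2_addxx addr0 F2_eq_sum0.
  by split=> [[-> _]|->].
Qed.

End Jump.

End Vertex.

End EulerCounting.

(** * Solutions of the compatibility conditions and the kernel of the chosen columns *)

Section CircuitNullity.

Variable F : graph.
Implicit Types (g h k : halfedge F) (v w : vertex F).

Hypothesis F4 : four_regular F.
Variables C P : {set {set walk F}}.
Hypotheses (eC : euler_system C) (cP : circuit_partition P).

Let cC : circuit_partition C. Proof. by case/andP: eC. Qed.
Let t v := passage_transition cP v.

Definition row_condition (y : vertex F -> 'F_2) v : 'F_2 :=
  (if is_phi C (t v) then y v
   else if is_chi C (t v) then interlace_sum C y v
   else y v + interlace_sum C y v)%R.

Definition solutions : {set {ffun vertex F -> 'F_2}} :=
  [set y : {ffun vertex F -> 'F_2} | [forall v, row_condition y v == 0%R]].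

Let vertex_halfedge v : exists h, inc h == v.
Proof.
have /card_gt0P[h hv] : 0 < #|star v| by rewrite F4.
by exists h; rewrite -mem_star.
Qed.

Lemma invariantP (f : {ffun halfedge F -> 'F_2}) :
  reflect ((forall h, f (mate h) = f h) /\ (forall h, f (turn P h) = f h))
          (f \in invariant_functions P).
Proof.
rewrite inE; apply: (iffP forallP) => [H|[H1 H2] h]; last by rewrite H1 H2 !eqxx.
by split=> h; case/andP: (H h) => /eqP ? /eqP.
Qed.

Lemma componentP (f : {ffun halfedge F -> 'F_2}) :
  reflect ((forall h, f (mate h) = f h) /\ (forall h k, inc h = inc k -> f h = f k))
          (f \in component_functions F).
Proof.
rewrite inE; apply: (iffP forallP) => [H|[H1 H2] h]; last first.
  by rewrite H1 eqxx /=; apply/forall_inP=> k /eqP/H2->.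
split=> [h|h k E]; first by case/andP: (H h) => /eqP.
by case/andP: (H k) => _ /forall_inP/(_ h); rewrite E eqxx => /(_ isT)/eqP.
Qed.

Lemma invariant_jump (f : halfedge F -> 'F_2) (y : vertex F -> 'F_2) :
  (forall h, f (mate h) = f h) -> (forall h, (f h + f (turn C h) = y (inc h))%R) ->
  (forall h, f (turn P h) = f h) <-> (forall v, row_condition y v = 0%R).
Proof.
move=> fm ft.
have W v : (forall g, g \in star v -> f (turn P g) = f g) <-> row_condition y v = 0%R.
  have [h [k [p [q [Cs <- ik vp vq]]]]] := euler_split F4 eC v.
  exact: (compatible_jump F4 eC cP Cs ik vp vq fm ft).
split=> [H v|H h]; first by apply/W.
by apply: (iffRL (W (inc h))); rewrite ?mem_star.
Qed.

Lemma constant_on_components (f : halfedge F -> 'F_2) :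
  (forall h, f (mate h) = f h) -> (forall h, f (turn C h) = f h) ->
  forall h k, inc h = inc k -> f h = f k.
Proof.
move=> fm ft h k E; have [s Cs hs] := trail_of_ex cC h.
have := euler_star eC Cs E; rewrite hs => /(_ isT)/orP[] ks.
  exact: (invariant_trail cC fm ft Cs hs ks).
by rewrite -(fm k); apply: (invariant_trail cC fm ft Cs hs ks).
Qed.

(** Every invariant function is uniquely the potential of its jumps plus a function constant on
    components. *)
Lemma card_invariant_solutions :
  #|invariant_functions P| = #|solutions| * #|component_functions F|.
Proof.
pose fS (z : {ffun vertex F -> 'F_2} * {ffun halfedge F -> 'F_2}) :
    {ffun halfedge F -> 'F_2} := [ffun h => potential C z.1 h + z.2 h]%R.
have fSm z : z.2 \in component_functions F -> forall h, fS z (mate h) = fS z h.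
  by case/componentP=> zm _ h; rewrite !ffunE (potential_mate eC) zm.
have fSt z : z.2 \in component_functions F ->
    forall h, (fS z h + fS z (turn C h) = z.1 (inc h))%R.
  case/componentP=> _ zi h; rewrite !ffunE (zi (turn C h) h) ?inc_turn //.
  by rewrite addrACA F2_addxx addr0 (potential_turn F4 eC).
rewrite -cardsX; have <- : fS @: setX solutions (component_functions F) = invariant_functions P.
  apply/setP=> f; apply/imsetP/idP => [[z +]|/invariantP[fm fP]].
    rewrite inE => /andP[zS zG] ->; apply/invariantP; split; first exact: fSm.
    apply/(invariant_jump (fSm _ zG) (fSt _ zG)) => v.
    by move: zS; rewrite inE => /forallP/(_ v)/eqP.
  have [a Ea] := fin_all_exists vertex_halfedge.
  (* The choice of the half-edge [a v] is immaterial, since [jump_const] gives all half-edges at [v]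
     the same jump. *)
  pose y : {ffun vertex F -> 'F_2} := [ffun v => f (a v) + f (turn C (a v))]%R.
  have ft h : (f h + f (turn C h) = y (inc h))%R.
    rewrite ffunE.
    have [h' [k [p [q [Cs ih ik vp vq]]]]] := euler_split F4 eC (inc h).
    have J g : inc g = inc h -> (f g + f (turn C g) = f h' + f (turn C h'))%R.
      move=> E; rewrite -ih in ik E.
      by apply: (jump_const F4 eC cP Cs ik fP); rewrite mem_star E.
    by rewrite !J //; apply/eqP.
  (* In characteristic 2 this sum is the difference from the potential; its jumps cancel, so it is
     constant on components. *)
  pose g : {ffun halfedge F -> 'F_2} := [ffun h => f h + potential C y h]%R.
  have gG : g \in component_functions F.
    have gm h : g (mate h) = g h by rewrite !ffunE fm (potential_mate eC).
    apply/componentP; split=> //; apply: constant_on_components => // h.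
    apply/F2_eq_sum0; rewrite addrC !ffunE addrACA ft.
    by rewrite (potential_turn F4 eC) ?inc_turn // ffunE F2_addxx.
  exists (y, g).
    rewrite inE gG andbT inE; apply/forallP=> v; apply/eqP.
    by apply: (iffLR (invariant_jump fm ft)).
  by apply/ffunP=> h; rewrite !ffunE /= ?ffunE addrCA F2_addxx addr0.
rewrite card_in_imset // => z z' zX z'X E.
have zG : z.2 \in component_functions F by move: zX; rewrite inE => /andP[].
have z'G : z'.2 \in component_functions F by move: z'X; rewrite inE => /andP[].
have E1 : z.1 = z'.1.
  apply/ffunP=> v; have [h /eqP <-] := vertex_halfedge v.
  by rewrite -(fSt z zG) -(fSt z' z'G) E.
rewrite [z]surjective_pairing [z']surjective_pairing E1; congr (_, _).
apply/ffunP=> h; have := congr1 (fun u : {ffun _} => u h) E.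
by rewrite !ffunE E1 => /addrI.
Qed.

Let A := transitions_of P.
Let M := ((column_submatrix (transition_column C) A)^T)%R.

Let tA v : t v \in A.
Proof. by rewrite inE. Qed.

Let A_t s : s \in A -> s = t (tvertex s).
Proof. by rewrite inE => /eqP E; apply: transition_inj. Qed.

(** At a phi vertex [y v] is forced to be 0, while the kernel vector has a coordinate for the unit
    column there. The row equation at that vertex makes this coordinate the interlacement sum. *)
Definition solution_vector (y : {ffun vertex F -> 'F_2}) : 'rV['F_2]_#|A| :=
  (\row_j (let v := tvertex (enum_val j) in
           if is_phi C (t v) then interlace_sum C y v else y v))%R.

(** Phi columns contribute only an identity entry, chi columns only interlacement entries, and psi
    columns both. *)
Lemma mul_column_submatrix (u : 'rV['F_2]_#|A|) (x : vertex F -> 'F_2) :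
  (forall j, u 0%R j = x (tvertex (enum_val j))) -> forall w,
  ((u *m M) 0 (enum_rank w) =
   (if is_phi C (t w) then x w else if is_chi C (t w) then 0 else x w)
   + interlace_sum C (fun v => if is_phi C (t v) then 0 else x v) w)%R.
Proof.
move=> ux w; rewrite mxE.
transitivity (\sum_(s in A) x (tvertex s) * transition_column C s (enum_rank w) 0)%R.
  by rewrite [RHS]big_enum_val; apply: eq_bigr => j _; rewrite ux !mxE.
have t_inj : injective t by move=> v v' /(congr1 (@tvertex F)).
rewrite /A (transitions_ofE cP) big_imset /=; last by move=> v v' _ _; apply: t_inj.
transitivity (\sum_v ((if v == w then
    if is_phi C (t w) then x w else if is_chi C (t w) then 0 else x w else 0)
    + (interlaced C w v)%:R * (if is_phi C (t v) then 0 else x v)))%R.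
  apply: eq_bigr => v _; rewrite -/(t v).
  have -> : transition_column C (t v) (enum_rank w) 0%R =
      (if is_phi C (t v) then (w == v)%:R else if is_chi C (t v) then (interlaced C w v)%:R
       else (w == v)%:R + (interlaced C w v)%:R)%R.
    by rewrite mxE; case: ifP => _; [|case: ifP => _];
      rewrite !mxE ?enum_rankK ?(inj_eq enum_rank_inj).
  rewrite [w == v]eq_sym -[tvertex (t v)]/v.
  case: eqP => [->|_]; case: ifP => _; rewrite ?mulr1 ?mulr0 ?addr0 ?add0r //.
  - by case: ifP => _; rewrite ?mulrDr ?mulr1 ?add0r // mulrC.
  - by case: ifP => _; rewrite mulrC.
by rewrite big_split /= -big_mkcond big_pred1_eq.
Qed.

Lemma card_solutions : #|solutions| = 2 ^ (#|A| - transition_matroid C A).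
Proof.
have -> : 2 ^ (#|A| - transition_matroid C A) = #|rowg (kermx M)|.
  by rewrite card_rowg card_Fp // mxrank_ker mxrank_tr.
have <- : solution_vector @: solutions = rowg (kermx M).
  apply/setP=> u; rewrite inE sub_kermx; apply/imsetP/eqP => [[y]|uM].
    rewrite inE => /forallP yS ->.
    apply/rowP=> i; rewrite -(enum_valK i) [RHS]mxE; move: (enum_val i) => w {i}.
    rewrite (mul_column_submatrix
      (x := fun v => if is_phi C (t v) then interlace_sum C y v else y v)).
      have -> : interlace_sum C (fun v => if is_phi C (t v) then 0 else
          if is_phi C (t v) then interlace_sum C y v else y v)%R w = interlace_sum C y w.
        apply: eq_bigr => v _; congr (_ * _)%R; have := yS v; rewrite /row_condition.
        by case: ifP => // _ /eqP.
      have := yS w; rewrite /row_condition; case: ifP => _; first by rewrite F2_addxx.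
      by case: ifP => _ /eqP; rewrite ?add0r.
    by move=> j; rewrite mxE.
  pose x v := u 0%R (enum_rank_in (tA v) (t v)).
  have ux j : u 0%R j = x (tvertex (enum_val j)).
    rewrite /x; congr (u _ _); apply: enum_val_inj; rewrite enum_rankK_in ?tA //.
    exact: A_t (enum_valP j).
  have xS w := congr1 (fun m : 'rV_#|vertex F| => m 0%R (enum_rank w)) uM.
  (* The phi coordinates are discarded; the row equations recover them from the others. *)
  pose y : {ffun vertex F -> 'F_2} := [ffun v => if is_phi C (t v) then 0%R else x v].
  have yE w : interlace_sum C (fun v => if is_phi C (t v) then 0 else x v)%R w
      = interlace_sum C y w.
    by apply: eq_bigr => v _; rewrite ffunE.
  exists y.
    rewrite inE; apply/forallP=> w; have := xS w.
    rewrite /= (mul_column_submatrix ux) yE mxE /row_condition ffunE => /eqP.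
    by case: ifP => // _; case: ifP => // _; rewrite add0r.
  apply/rowP=> j; rewrite ux mxE; move: (tvertex _) => w /=; have := xS w.
  rewrite /= (mul_column_submatrix ux) yE mxE ffunE.
  by case: ifP => // _ /F2_eq_sum0.
rewrite card_in_imset // => y y'; rewrite !inE => /forallP yS /forallP y'S E.
apply/ffunP=> v; have := yS v; have := y'S v; rewrite /row_condition.
have := congr1 (fun m : 'rV_#|A| => m 0%R (enum_rank_in (tA v) (t v))) E.
rewrite /= !mxE enum_rankK_in //=; case: ifP => // _ _ /eqP-> /eqP-> //.
Qed.

Lemma circuit_nullity :
  #|P| = (#|A| - transition_matroid C A) + ncomponents F.
Proof.
have := card_invariant_functions cP.
rewrite card_invariant_solutions card_solutions card_component_functions.
  by rewrite -expnD => /eqP; rewrite eqn_exp2l // => /eqP.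
by move=> v; rewrite F4.
Qed.

End CircuitNullity.

(** * Recovering the Martin polynomials *)

Lemma digits_inj b n (f g : 'I_n -> nat) :
  (forall i, f i < b) -> (forall i, g i < b) ->
  \sum_i f i * b ^ i = \sum_i g i * b ^ i -> f =1 g.
Proof.
elim: n f g => [|n IH] f g fb gb E; first by case.
have S (u : 'I_n.+1 -> nat) :
    \sum_i u i * b ^ i = (\sum_(i < n) u (lift ord0 i) * b ^ i) * b + u ord0.
  rewrite big_ord_recl expn0 muln1 addnC big_distrl; congr (_ + _).
  by apply: eq_bigr => i _; rewrite lift0 expnSr mulnA.
have b0 : 0 < b by apply: leq_ltn_trans (fb ord0).
rewrite !S in E.
have E0 : f ord0 = g ord0.
  by have := congr1 (modn^~ b) E; rewrite !modnMDl !modn_small.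
move: E; rewrite E0 => /addIn/eqP; rewrite eqn_pmul2r // => /eqP E.
have E1 := IH (fun i => f (lift ord0 i)) (fun i => g (lift ord0 i))
  (fun i => fb _) (fun i => gb _) E.
by move=> i; case: (unliftP ord0 i) => [j ->|->].
Qed.

Section CoefficientSum.

Variables (K : nzRingType) (W : zmodType) (phi : nat -> K -> W).
Hypothesis phiD : forall j, {morph phi j : a b / (a + b)%R}.

(** [phi j] is only assumed additive, which suffices for reading off coefficients and for applying
    [diagonal], neither of which is linear over the coefficient ring. *)
Definition coef_sum (p : {poly K}) : W := (\sum_(j < size p) phi j p`_j)%R.

Let phi0 j : phi j 0%R = 0%R.
Proof. by apply: (addrI (phi j 0)%R); rewrite -phiD !addr0. Qed.

Lemma coef_sum_widen n (p : {poly K}) :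
  size p <= n -> coef_sum p = (\sum_(j < n) phi j p`_j)%R.
Proof.
move=> pn; rewrite /coef_sum (big_ord_widen n (fun j => phi j p`_j)%R) // big_mkcond.
apply: eq_bigr => j _; case: ltnP => // pj.
by rewrite nth_default.
Qed.

Lemma coef_sum0 : coef_sum 0 = 0%R.
Proof. by rewrite /coef_sum size_poly0 big_ord0. Qed.

Lemma coef_sumD : {morph coef_sum : p q / (p + q)%R}.
Proof.
move=> p q; set n := maxn (size p) (size q).
rewrite !(@coef_sum_widen n) ?leq_maxl ?leq_maxr ?(leq_trans (size_polyD p q)) //.
by rewrite -big_split; apply: eq_bigr => j _; rewrite coefD phiD.
Qed.

Lemma coef_sum_monomial c n : coef_sum (c%:P * 'X^n)%R = phi n c.
Proof.
rewrite (@coef_sum_widen n.+1).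
  rewrite big_ord_recr /= coefMXn ltnn subnn coefC eqxx big1 ?add0r // => j _.
  by rewrite coefMXn ltn_ord.
rewrite (leq_trans (size_polyMleq _ _)) // size_polyXn addnS /=.
by rewrite -[X in _ <= X]add1n leq_add2r size_polyC leq_b1.
Qed.

End CoefficientSum.

Section MartinCoefficients.

Local Open Scope ring_scope.

(* In {poly {poly int}}, 'X is the s and ('X)%:P the t of the header. *)
Definition weight_in (V : finType) (v : V) : {poly {poly int}} := 'X^(4 ^ enum_rank v)%N.
Definition weight_out (V : finType) (v : V) : {poly {poly int}} := ('X^(4 ^ enum_rank v)%N)%:P.

(** The sum of the coefficients of the monomials s^j t^(2j): a transversal chooses one of the three
    transitions at each vertex and omits two. *)
Definition diagonal (w : {poly {poly int}}) : int :=
  coef_sum (fun j (p : {poly int}) => p`_(2 * j)) w.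

(* Substituting 2 for x and 'X + 1 for y turns x - 1 into 1 and y - 1 into 'X. *)
Definition martin_of (c : nat) (T : {poly {poly {poly {poly int}}}}) : {poly int} :=
  coef_sum (fun k w => (diagonal w)%:P * ('X - 1) ^+ (k + (c - 1)))
    ((map_poly (horner_eval 2) T) \Po ('X + 1)).

Lemma diagonalD : {morph diagonal : a b / a + b}.
Proof. by apply: coef_sumD => j a b; rewrite coefD. Qed.

Lemma martin_ofD c : {morph martin_of c : S T / S + T}.
Proof.
move=> S T; rewrite /martin_of rmorphD comp_polyD coef_sumD // => k a b.
by rewrite diagonalD polyCD mulrDl.
Qed.

Lemma martin_of_term c w i j :
  martin_of c ((w%:P)%:P * ('X%:P - 1) ^+ i * ('X - 1) ^+ j)
  = (diagonal w)%:P * ('X - 1) ^+ (j + (c - 1)).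
Proof.
rewrite /martin_of !rmorphM !rmorphXn !rmorphB !rmorph1 /= !map_polyC map_polyX /=.
rewrite /horner_eval hornerC hornerX !comp_polyC comp_polyX.
have -> : (2%:P - 1 : {poly {poly {poly int}}}) = 1.
  by rewrite -polyC1 -polyCB (_ : 2 - 1 = 1) // mulr2n addrK.
rewrite expr1n mulr1 addrK coef_sum_monomial // => k a b.
by rewrite diagonalD polyCD mulrDl.
Qed.

Lemma diagonal_monomial m n : diagonal ('X^m * ('X^n)%:P) = (2 * m == n)%N%:R.
Proof.
by rewrite mulrC /diagonal coef_sum_monomial => [|j a b]; rewrite ?coefXn ?coefD.
Qed.

Variables (V S : finType) (f : S -> V).
Hypothesis fibers : forall v, #|[set s | f s == v]| = 3%N.

Let rank_sum (B : {set S}) := (\sum_(s in B) 4 ^ enum_rank (f s))%N.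

Let rank_sumE B : rank_sum B =
  (\sum_(i < #|V|) #|[set s in B | f s == enum_val i]| * 4 ^ i)%N.
Proof.
rewrite /rank_sum (partition_big f predT) //= big_enum_val /=.
apply: eq_bigr => i _; rewrite -sum_nat_const; apply: eq_big => s; first by rewrite inE.
by case/andP=> _ /eqP ->; rewrite enum_valK.
Qed.

(** Chosen and omitted exponents add up to three times the sum of all 4^i, so the equation says that
    the chosen exponent has all base 4 digits equal to 1. The digits are the fiber counts, at most
    3, so there are no carries. *)
Lemma double_rank_sum (B : {set S}) :
  (2 * rank_sum B == rank_sum (~: B))%N = [forall v, #|[set s in B | f s == v]| == 1%N].
Proof.
have T : (rank_sum B + rank_sum (~: B) = 3 * \sum_(i < #|V|) 1 * 4 ^ i)%N.
  transitivity (rank_sum [set: S]).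
    rewrite {3}/rank_sum (bigID (mem B)) /=; congr (_ + _)%N.
      by apply: eq_bigl => s; rewrite inE.
    by apply: eq_bigl => s; rewrite !inE.
  rewrite rank_sumE big_distrr /=; apply: eq_bigr => i _.
  rewrite mul1n -(fibers (enum_val i)); congr (_ * _)%N.
  by apply: eq_card => s; rewrite !inE.
have {T} -> : (2 * rank_sum B == rank_sum (~: B))%N
    = (rank_sum B == \sum_(i < #|V|) 1 * 4 ^ i)%N.
  by move: T; move: (rank_sum B) (rank_sum _) (\sum_(i < _) _)%N => x y z; lia.
rewrite rank_sumE; apply/eqP/forallP => [E v|H]; last first.
  by apply: eq_bigr => i _; rewrite (eqP (H _)).
have D := digits_inj _ _ E.
rewrite -(enum_rankK v) D // => i.
apply: leq_trans (_ : #|[set s | f s == enum_val i]| < 4)%N; last by rewrite fibers.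
by rewrite ltnS; apply/subset_leq_card/subsetP=> s; rewrite !inE => /andP[].
Qed.

(** A chosen element outside [q] makes the product of weights zero. For the other subsets [diagonal]
    is 1 on transversals and 0 elsewhere, and the matroid enters only through the exponent. *)
Lemma martin_of_tutte (M : matroid S) (q : pred S) c :
  martin_of c (parametrized_tutte M (fun s => if q s then weight_in (f s) else 0)
                 (fun s => weight_out (f s)))
  = \sum_(B : {set S} | [forall v, #|[set s in B | f s == v]| == 1%N]
                        && [forall s in B, q s])
      ('X - 1) ^+ (#|B| - M B + (c - 1)).
Proof.
rewrite /parametrized_tutte (big_morph _ (martin_ofD c) (_ : martin_of c 0 = 0)); last first.
  by rewrite /martin_of rmorph0 comp_poly0 coef_sum0.
rewrite [RHS]big_mkcond; apply: eq_bigr => B _; rewrite martin_of_term.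
have -> : \prod_(s in ~: B) weight_out (f s) = ('X^(rank_sum (~: B)))%:P.
  by rewrite /weight_out -rmorph_prod /= prodrXr.
have [/forall_inP qB|/forall_inPn[s sB qs]] := boolP [forall s in B, q s].
  have -> : \prod_(s in B) (if q s then weight_in (f s) else 0) = 'X^(rank_sum B).
    by rewrite -prodrXr; apply: eq_bigr => s /qB ->.
  rewrite diagonal_monomial double_rank_sum andbT.
  by case: ifP; rewrite ?mul0r ?mul1r.
rewrite andbF (bigD1 s) //= (negPf qs) !mul0r.
by rewrite /diagonal coef_sum0 mul0r.
Qed.

End MartinCoefficients.

Lemma card_circuit_partition (F : graph) (C P : {set {set walk F}}) :
  four_regular F -> euler_system C -> circuit_partition P ->
  #|P| - 1 = #|transitions_of P| - transition_matroid C (transitions_of P)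
             + (ncomponents F - 1).
Proof.
move=> F4 eC cP; rewrite (circuit_nullity F4 eC cP).
(* Without components, the truncated |P| - 1 and c - 1 are both 0. *)
case: (posnP (ncomponents F)) => [c0|c_gt0]; last by rewrite addnBA.
rewrite c0 !addn0.
have V0 (v : vertex F) : False.
  have: 0 < ncomponents F.
    apply/card_gt0P; exists (fingraph.root (@adjacent F) v).
    by rewrite !inE roots_root //; exact: adjacent_sym.
  by rewrite c0.
have -> : transitions_of P = set0.
  by apply/setP=> t; case: (V0 (tvertex t)).
by rewrite cards0.
Qed.

Local Open Scope ring_scope.

(* "Determine" is a function (m, resp. m') of the number of components and of
   the parametrized Tutte polynomial, fixed before the graph. The weights of a
   transition may depend only on its vertex and, in the directed case, on
   whether it is consistent with the orientation; the rules for choosing them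
   are also fixed before the graph. *)
Theorem theorem9 :
  exists (R : comNzRingType)
    (a b : forall V : finType, V -> R)
    (a' b' : forall V : finType, V -> bool -> R)
    (m m' : nat -> {poly {poly R}} -> {poly int}),
  forall (F : graph) (C : {set {set walk F}}),
    four_regular F -> euler_system C ->
    m (ncomponents F)
      (parametrized_tutte (transition_matroid C)
         (fun t => a (vertex F) (tvertex t))
         (fun t => b (vertex F) (tvertex t)))
    = martin F
    /\ forall D : {set halfedge F}, balanced_orientation D ->
       m' (ncomponents F)
         (parametrized_tutte (transition_matroid C)
            (fun t => a' (vertex F) (tvertex t) (consistent D (tpairs t)))
            (fun t => b' (vertex F) (tvertex t) (consistent D (tpairs t))))
       = directed_martin D.
Proof.
exists {poly {poly int}}, weight_in, weight_out.
exists (fun V v q => if q then @weight_in V v else 0), (fun V v _ => @weight_out V v).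
exists martin_of, martin_of => F C F4 eC.
(* Both identities are instances: [q] is constantly true for the Martin polynomial and
   [consistent D] for the directed one. *)
have K (q : {set {set halfedge F}} -> bool) :
    martin_of (ncomponents F) (parametrized_tutte (transition_matroid C)
      (fun t => if q (tpairs t) then weight_in (tvertex t) else 0)
      (fun t => weight_out (tvertex t)))
    = \sum_(P : {set {set walk F}} | circuit_partition P && [forall v, q (passages P v)])
        ('X - 1) ^+ (#|P| - 1).
  rewrite (martin_of_tutte (fun v => card_transitions (F4 v)) _ (fun t => q (tpairs t))).
  rewrite -(sum_transversals q
    (fun A => ('X - 1) ^+ (#|A| - transition_matroid C A + (ncomponents F - 1)))).
  by apply: eq_bigr => P /andP[cP _]; rewrite (card_circuit_partition F4 eC cP).
split=> [|D _]; last exact: (K (consistent D)).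
rewrite [LHS](K xpredT); apply: eq_bigl => P.
by rewrite andb_idr // => _; apply/forallP.
Qed.
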